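(* Let $k\ge1$ be odd, let $\mathcal T$ be a triangulation of $\Omega$ and let $f\in L^2(\Omega)$. There is a constant $C>0$ depending only on $k$ and $\gamma_{\mathcal T}$ such that for every admissible refinement $\widehat{\mathcal T}\in\mathbb T(\mathcal T)$, all $v\in\mathrm{CR}_{k,0}(\mathcal T)$ and all $\widehat v\in\mathrm{CR}_{k,0}(\widehat{\mathcal T})$, $$\big|\eta(v;\mathcal T\cap\widehat{\mathcal T},f)-\eta(\widehat v;\widehat{\mathcal T}\cap\mathcal T,f)\big|\le C\,\|\nabla_{\mathcal T}v-\nabla_{\widehat{\mathcal T}}\widehat v\|_{L^2(\Omega)},$$ where $\eta(v;\cdot,f)$ is computed with respect to the mesh $\mathcal T$ and $\eta(\widehat v;\cdot,f)$ with respect to the mesh $\widehat{\mathcal T}$.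
   Context: $\Omega\subseteq\mathbb R^2$ is a bounded open polygonal Lipschitz domain. A triangulation $\mathcal T$ of $\Omega$ is a finite set of closed triangles covering $\overline\Omega$ that is conforming: two distinct triangles intersect in a common edge, a common vertex, or not at all. $h_K$ is the diameter of $K$, $|K|$ its area, $\rho_K$ the diameter of its largest inscribed ball, and $\gamma_{\mathcal T}:=\max_{K\in\mathcal T}h_K/\rho_K$. $\mathcal E(K)$ is the set of edges of $K$, $\mathcal E(\mathcal T)$ the set of all edges, $\mathcal E_{\partial\Omega}(\mathcal T)$ the edges contained in $\partial\Omega$, $\mathcal E_\Omega(\mathcal T)$ the remaining (interior) edges, and $\mathcal E_\Omega(K)=\mathcal E(K)\cap\mathcal E_\Omega(\mathcal T)$. Each triangle of $\mathcal T$ has a designated newest vertex. Newest vertex bisection (NVB) of a triangle joins its newest vertex to the midpoint of the opposite edge; that midpoint becomes the newest vertex of both children. $\mathbb T(\mathcal T)$ is the set of (conforming) triangulations obtained from $\mathcal T$ by finitely many newest vertex bisections. Each edge $E$ has a fixed ordering $\mathbf z_0,\mathbf z_1$ of its endpoints; $\mathbf t_E=(\mathbf z_1-\mathbf z_0)/|E|$ and $\mathbf n_E=(-t_{E,2},t_{E,1})^T$; for boundary edges the ordering is such that $\mathbf n_E$ is exterior to $\Omega$. For an interior edge, $K_L,K_R$ are the two adjacent triangles with $\mathbf n_E$ pointing into $K_R$; for a boundary edge, $K_L$ is the adjacent triangle. The jump is $[v]_E=v|_{K_L}|_E-v|_{K_R}|_E$ for interior $E$ and $[v]_E=v|_{K_L}|_E$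 for boundary $E$ (componentwise for vector fields). $\nabla_{\mathcal T}$ is the piecewise gradient. $\mathbb P_k$ denotes polynomials of total degree at most $k$, and $\mathbb P_k(\mathcal T)$ the functions that are in $\mathbb P_k(K)$ on every $K\in\mathcal T$. $\mathrm{CR}_{k,0}(\mathcal T)$ is the space of $v\in\mathbb P_k(\mathcal T)$ such that $[v]_E$ is $L^2(E)$-orthogonal to $\mathbb P_{k-1}(E)$ for all $E\in\mathcal E(\mathcal T)$ (interior and boundary). For $v\in\mathbb P_k(\mathcal T)$, $f\in L^2(\Omega)$, $K\in\mathcal T$ and $\mathcal S\subseteq\mathcal T$: $$\mu(v;K,f)^2=|K|\,\|f+\Delta v\|_{L^2(K)}^2+|K|^{1/2}\sum_{E\in\mathcal E_\Omega(K)}\|[\nabla_{\mathcal T}v]_E\cdot\mathbf n_E\|_{L^2(E)}^2,$$ $$\nu(v;K)^2=|K|^{1/2}\sum_{E\in\mathcal E(K)}\|[\nabla_{\mathcal T}v]_E\cdot\mathbf t_E\|_{L^2(E)}^2,$$ $\eta(v;K,f)^2=\mu(v;K,f)^2+\nu(v;K)^2$ and $\eta(v;\mathcal S,f)^2=\sum_{K\in\mathcal S}\eta(v;K,f)^2$. The same notation is used on $\widehat{\mathcal T}$. *)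

(* Defs.v *)
From HB Require Import structures.
From mathcomp Require Export all_boot all_order all_algebra.
From mathcomp Require Export polyXY finmap.
From mathcomp Require Export all_classical all_reals all_analysis.
Set Implicit Arguments.
Unset Strict Implicit.
Unset Printing Implicit Defensive.
Export Order.TTheory GRing.Theory Num.Theory.
Export numFieldNormedType.Exports.

Local Open Scope classical_set_scope.
Local Open Scope ring_scope.

Notation pt R := (R * R)%type.

(* Triangles and edges are represented by their (finite) sets of vertices;
   the corresponding closed subsets of the plane are obtained with [hull]. *)
Notation cell R := {fset (pt R)}.

Section Plane.
Context {R : realType}.
Implicit Types (a b x y z : pt R) (A Omega : set (pt R)) (K E : cell R).

Definition dot a b : R := a.1 * b.1 + a.2 * b.2.

(* The library norm on [R * R] is the maximum norm. *)
Definition enorm a : R := Num.sqrt (dot a a).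

Definition rot90 a : pt R := (- a.2, a.1).

Definition hull K : set (pt R) :=
  [set x | exists w : pt R -> R, [/\ forall z, z \in K -> 0 <= w z,
     \sum_(z <- K) w z = 1 & x = \sum_(z <- K) w z *: z]].

Definition midpoint a b : pt R := 2^-1 *: (a + b).

Definition boundary A : set (pt R) := closure A `\` interior A.

Definition polygonal Omega :=
  exists s : seq (pt R * pt R),
    boundary Omega = [set x | exists2 e, e \in s & hull [fset e.1; e.2]%fset x].

(* Near each boundary point x there are orthonormal coordinates (s, t) centred
   at x, with axes e and rot90 e, in which Omega is the strict epigraph of a
   Lipschitz function. *)
Definition lipschitz_boundary Omega :=
  forall x, boundary Omega x ->
  exists (e : pt R) (r h L : R) (g : R -> R),
    [/\ enorm e = 1, 0 < r, 0 < h,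
        forall s t : R, `|g s - g t| <= L * `|s - t| &
        forall s t : R, `|s| < r -> `|t| < h ->
          (Omega (x + s *: e + t *: rot90 e) <-> g s < t)].

Definition polygonal_lipschitz_domain Omega :=
  [/\ open Omega, connected Omega, Omega !=set0, bounded_set Omega &
      polygonal Omega /\ lipschitz_boundary Omega].

Definition is_triangle K :=
  exists a b c, K = [fset a; b; c]%fset /\ dot (rot90 (b - a)) (c - a) != 0.

Definition edges K : {fset cell R} :=
  [fset E in fpowerset K | #|` E| == 2]%fset.

(* The product of the one-dimensional Lebesgue measures, on Borel sets. *)
Definition leb2 :
    {measure set (measurableTypeR R * measurableTypeR R)%type -> \bar R} :=
  (@lebesgue_measure R \x @lebesgue_measure R)%E.

Definition diam A : R :=
  sup [set d | exists x y, [/\ A x, A y & d = enorm (x - y)]].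

Definition rho A : R :=
  sup [set d | 0 <= d /\ exists c, forall x, enorm (x - c) <= d / 2 -> A x].

Definition area K : R := fine (leb2 (hull K)).

Definition L2norm A (g : pt R -> R) : R :=
  fine ('N[leb2]_2%:E[EFin \o (g \_ A)])%E.

End Plane.

Section Triangulations.
Context {R : realType}.
Implicit Types (Omega : set (pt R)) (K E : cell R) (T : {fset cell R}).

Definition conforming T :=
  forall K K', K \in T -> K' \in T -> K != K' ->
  [\/ hull K `&` hull K' = set0,
      exists z, [/\ z \in K, z \in K' & hull K `&` hull K' = [set z]] |
      exists E, [/\ E \in edges K, E \in edges K'
                  & hull K `&` hull K' = hull E]].

Definition triangulation Omega T :=
  [/\ forall K, K \in T -> is_triangle K,
      \bigcup_(K in [set` T]) hull K = closure Omega & conforming T].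

Definition gamma T : R :=
  \big[Num.max/0]_(K <- T) (diam (hull K) / rho (hull K)).

Definition mesh_edge T E := exists2 K, K \in T & E \in edges K.

Definition boundary_edge Omega E := hull E `<=` boundary Omega.

(* [nvb_reach T0 nv0 T nv]: finitely many bisections, starting from the
   triangles T0 with newest vertices nv0, lead to T with newest vertices nv.
   Intermediate collections of triangles need not be conforming. *)
Inductive nvb_reach (T0 : {fset cell R}) (nv0 : cell R -> pt R) :
    {fset cell R} -> (cell R -> pt R) -> Prop :=
| nvb_refl : nvb_reach T0 nv0 T0 nv0
| nvb_bisect T nv K (a b : pt R) :
    nvb_reach T0 nv0 T nv -> K \in T ->
    is_triangle K -> K = [fset nv K; a; b]%fset ->
    let m := midpoint a b in
    let children := [fset [fset nv K; a; m]; [fset nv K; b; m]]%fset in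
    nvb_reach T0 nv0 ((T `\ K) `|` children)%fset
      (fun K' => if K' \in children then m else nv K').

Definition newest_vertices T (nv : cell R -> pt R) :=
  forall K, K \in T -> nv K \in K.

Definition admissible_refinement Omega T nv That :=
  triangulation Omega That /\ exists nv', nvb_reach T nv That nv'.

End Triangulations.

Section Edges.
Context {R : realType}.
Implicit Types (Omega : set (pt R)) (K E : cell R) (T : {fset cell R}).
(* [o E] is the ordered pair of the endpoints of E. *)
Implicit Type o : cell R -> pt R * pt R.

Definition elen o E : R := enorm ((o E).2 - (o E).1).
Definition tangent o E : pt R := (elen o E)^-1 *: ((o E).2 - (o E).1).
Definition normal o E : pt R := rot90 (tangent o E).
Definition epoint o E (t : R) : pt R := (o E).1 + t *: ((o E).2 - (o E).1).

Definition orientation Omega T o :=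
  forall E, mesh_edge T E ->
    E = [fset (o E).1; (o E).2]%fset /\
    (boundary_edge Omega E -> forall t : R, 0 < t < 1 ->
      \forall eps \near 0^'+, ~ Omega (epoint o E t + eps *: normal o E)).

Definition adjacent T E : set (cell R) :=
  [set K | K \in T /\ E \in edges K].

Definition points_into o E K :=
  \forall eps \near 0^'+, hull K (epoint o E 2^-1 + eps *: normal o E).

Definition KR T o E : cell R :=
  xget fset0 [set K | adjacent T E K /\ points_into o E K].

Definition KL Omega T o E : cell R :=
  if `[< boundary_edge Omega E >] then xget fset0 (adjacent T E)
  else xget fset0 [set K | adjacent T E K /\ K <> KR T o E].

(* [w K] extends the restriction of a piecewise function to the triangle K. *)
Definition jump (V : zmodType) Omega T o (w : cell R -> pt R -> V) E (x : pt R)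
    : V :=
  if `[< boundary_edge Omega E >] then w (KL Omega T o E) x
  else w (KL Omega T o E) x - w (KR T o E) x.

(* Integral over E with respect to arc length. *)
Definition edge_integral o E (g : pt R -> R) : R :=
  elen o E * \int[lebesgue_measure]_(t in `[0%R, 1%R]) g (epoint o E t).

Definition edge_L2norm o E (g : pt R -> R) : R :=
  Num.sqrt (edge_integral o E (fun x => g x ^+ 2)).

End Edges.

Section Polynomials.
Context {R : realType}.
(* The outer indeterminate is the first coordinate. *)
Implicit Types (p : {poly {poly R}}) (x : pt R).

Definition total_degree_le k p := forall i j, (k < i + j)%N -> p`_i`_j = 0.

Definition peval p x : R := p.[x.1, x.2].

Definition d1 p : {poly {poly R}} := p^`().
Definition d2 p : {poly {poly R}} := map_poly (fun q => q^`()) p.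

Definition grad p x : pt R := (peval (d1 p) x, peval (d2 p) x).
Definition laplacian p x : R := peval (d1 (d1 p) + d2 (d2 p)) x.

End Polynomials.

Section Estimator.
Context {R : realType}.
Implicit Types (Omega : set (pt R)) (K E : cell R) (T S : {fset cell R}).
Implicit Type o : cell R -> pt R * pt R.
(* A piecewise polynomial is given by one polynomial for each triangle; only
   its values at the triangles of the mesh matter. *)
Implicit Type v : cell R -> {poly {poly R}}.

Definition piecewise_poly k T v :=
  forall K, K \in T -> total_degree_le k (v K).

Definition CR0 k Omega T o v :=
  piecewise_poly k T v /\
  forall E, mesh_edge T E ->
  forall q : {poly {poly R}}, total_degree_le k.-1 q ->
    edge_integral o E (fun x =>
      jump Omega T o (fun K => peval (v K)) E x * peval q x) = 0.

(* The piecewise gradient, set to 0 on the (null) union of the edges. *)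
Definition pgrad T v (x : pt R) : pt R :=
  \sum_(K <- T) (grad (v K) \_ (interior (hull K))) x.

Definition grad_jump Omega T o v E (x : pt R) : pt R :=
  jump Omega T o (fun K => grad (v K)) E x.

(* f is only relevant on Omega; it is extended by 0 to the null set
   boundary Omega, which may meet the closed triangle K. *)
Definition mu2 Omega T o v K (f : pt R -> R) : R :=
  area K * L2norm (hull K) (fun x => (f \_ Omega) x + laplacian (v K) x) ^+ 2
  + Num.sqrt (area K) *
    \sum_(E <- edges K | ~~ `[< boundary_edge Omega E >])
      edge_L2norm o E
        (fun x => dot (grad_jump Omega T o v E x) (normal o E)) ^+ 2.

Definition nu2 Omega T o v K : R :=
  Num.sqrt (area K) *
    \sum_(E <- edges K)
      edge_L2norm o E
        (fun x => dot (grad_jump Omega T o v E x) (tangent o E)) ^+ 2.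

Definition eta2 Omega T o v K f : R :=
  mu2 Omega T o v K f + nu2 Omega T o v K.

Definition eta Omega T o v S f : R :=
  Num.sqrt (\sum_(K <- S) eta2 Omega T o v K f).

End Estimator.

(* Main.v *)
Require Import Defs.
From mathcomp Require Import qpoly measurable_realfun ring lra.
Import Order.TTheory GRing.Theory Num.Theory.
Import numFieldNormedType.Exports.
Set Implicit Arguments.
Unset Strict Implicit.
Unset Printing Implicit Defensive.
Local Open Scope classical_set_scope.
Local Open Scope ring_scope.

(* Both estimators are the l2-norm of a finite family of weighted L2-norms, so
   by the triangle inequality their difference is bounded by the estimator of
   the difference of the two discrete functions, taken over the common
   triangles. If an edge E of a common triangle is an edge of another triangle
   K' of the refined mesh, then K' is a triangle of T or a child of one: a
   second bisection would cut E. Hence K' is shape regular, the neighbours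
   across E in the two meshes are nested, and each term is controlled by the
   gradient of one polynomial on one triangle of the refined mesh.

   The trace and inverse inequalities are not obtained by scaling to a reference
   triangle: a shape regular triangle of size h contains a square of side
   comparable to h and lies in a comparable square, and by Lagrange interpolation
   on a grid the maximum M of |grad p| over the large square is attained, up to
   constants, on a whole box of side comparable to h inside the small one. The
   squared L2-norm of the gradient over the triangle is thus at least of order
   h^2 M^2. *)

(** * Barycentric coordinates *)

(** The two discrete functions live on different meshes, so their difference is formed on the
    refined one: [par] sends each triangle [K] of [That] to the triangle of [T] it descends from,
    and [v (par K) - vhat K] is a single polynomial. If [A K] bounds its derivatives and [l K] is
    the size of [K], all terms of the estimator are controlled by sums of [(A K * l K) ^ 2], each
    counted boundedly often. The same quantities bound the right-hand side from below, through
    disjoint boxes inside the triangles.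

    The jumps refer to adjacent triangles picked by a choice operator. To compare them across
    meshes, an edge must have at most one triangle on each side, an interior edge a triangle on both
    sides, and a boundary edge just one. The last fact is where the Lipschitz graph enters: no
    boundary point is interior to the closure of [Omega]. Since intermediate collections of bisected
    triangles need not be conforming, the history of bisections is used only to relate a triangle to
    its ancestor; everything about neighbours comes from the conformity of the two end meshes. *)

Section PlaneGeometry.
Context {R : realType}.
Implicit Types (a b c d x y z : pt R) (K E : cell R) (s t : R).

(** Twice the signed area of the triangle; its sign tells on which side of the line through [a] and
    [b] the point [c] lies. *)
Definition det3 a b c : R := dot (rot90 (b - a)) (c - a).

Lemma det3E a b c :
  det3 a b c = (b.1 - a.1) * (c.2 - a.2) - (b.2 - a.2) * (c.1 - a.1).
Proof. by rewrite /det3 /dot /rot90 /=; ring. Qed.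

Lemma det3_rot a b c : det3 b c a = det3 a b c.
Proof. by rewrite !det3E; ring. Qed.

Lemma det3_swap a b c : det3 b a c = - det3 a b c.
Proof. by rewrite !det3E; ring. Qed.

Lemma det3_neq0 a b c : det3 a b c != 0 -> [/\ a != b, b != c & a != c].
Proof.
by move=> h; split; apply: contraNneq h => ->; rewrite det3E; apply/eqP; ring.
Qed.

Lemma pairD x y : x + y = (x.1 + y.1, x.2 + y.2). Proof. by []. Qed.
Lemma pairZ s x : s *: x = (s * x.1, s * x.2). Proof. by []. Qed.
Lemma pairN x : - x = (- x.1, - x.2). Proof. by []. Qed.

Lemma det3_comb a b x y s t : s + t = 1 ->
  det3 a b (s *: x + t *: y) = s * det3 a b x + t * det3 a b y.
Proof.
move=> st; have -> : t = 1 - s by rewrite -st addrC addKr.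
by rewrite !det3E !pairZ /=; ring.
Qed.

Lemma det3_ray a b x d s :
  det3 a b (x + s *: d) = det3 a b x + s * dot (rot90 (b - a)) d.
Proof. by rewrite !det3E /dot !pairZ /=; ring. Qed.

(** Barycentric coordinate of [x] at the vertex [a]. The other two are obtained by rotating the
    arguments cyclically, so that facts can be stated for one vertex only. *)
Definition bary a b c x : R := det3 x b c / det3 a b c.

Lemma baryE a b c x : bary a b c x = det3 b c x / det3 a b c.
Proof. by rewrite /bary -(det3_rot x). Qed.

Lemma bary_sum a b c x : det3 a b c != 0 ->
  bary a b c x + bary b c a x + bary c a b x = 1.
Proof.
move=> h; rewrite /bary (det3_rot a b c) -(det3_rot c a b) -!mulrDl.
rewrite [X in X / _](_ : _ = det3 a b c) ?divff //.
by rewrite !det3E; ring.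
Qed.

Lemma bary_comb a b c x : det3 a b c != 0 ->
  x = bary a b c x *: a + bary b c a x *: b + bary c a b x *: c.
Proof.
move=> h; rewrite /bary (det3_rot a b c) -(det3_rot c a b).
move: h; rewrite !det3E; case: x => x1 x2 h.
by rewrite !pairZ /= !pairD /=; congr (_, _); field.
Qed.

Lemma bary_id a b c : det3 a b c != 0 ->
  [/\ bary a b c a = 1, bary a b c b = 0 & bary a b c c = 0].
Proof.
move=> h; split; rewrite /bary; first by rewrite divff.
  by rewrite [X in X / _](_ : _ = 0) ?mul0r // !det3E; ring.
by rewrite [X in X / _](_ : _ = 0) ?mul0r // !det3E; ring.
Qed.

Lemma bary_affine a b c x y s t : s + t = 1 ->
  bary a b c (s *: x + t *: y) = s * bary a b c x + t * bary a b c y.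
Proof. by move=> st; rewrite !baryE det3_comb // mulrDl -!mulrA. Qed.

Lemma bary_unique a b c u v w : det3 a b c != 0 -> u + v + w = 1 ->
  let x := u *: a + v *: b + w *: c in
  [/\ bary a b c x = u, bary b c a x = v & bary c a b x = w].
Proof.
move=> h uvw x; rewrite {}/x /bary (det3_rot a b c) -(det3_rot c a b).
have -> : u = 1 - v - w by rewrite -uvw; ring.
by move: h; rewrite !det3E => h; split; rewrite !pairZ !pairD /=; field.
Qed.

Lemma hull3P a b c x : det3 a b c != 0 ->
  hull [fset a; b; c]%fset x <->
  [/\ 0 <= bary a b c x, 0 <= bary b c a x & 0 <= bary c a b x].
Proof.
move=> h; have [ab bc ac] := det3_neq0 h.
have bigE (V : nmodType) (F : pt R -> V) :
    \sum_(z <- [fset a; b; c]%fset) F z = F a + F b + F c.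
  rewrite fsetUC big_fsetU1 ?big_fsetU1 ?big_seq_fset1 //=; first by rewrite addrC.
    by rewrite inE.
  by rewrite !inE negb_or eq_sym ac eq_sym bc.
split.
  case=> w [w0]; rewrite !bigE => w1 xE.
  have wa : 0 <= w a by apply: w0; rewrite !inE eqxx.
  have wb : 0 <= w b by apply: w0; rewrite !inE eqxx orbT.
  have wc : 0 <= w c by apply: w0; rewrite !inE eqxx !orbT.
  by rewrite xE; have [-> -> ->] := bary_unique h w1.
case=> ha hb hc.
exists (fun z => if z == a then bary a b c x else
                 if z == b then bary b c a x else bary c a b x).
split.
- by move=> z _; case: ifP => // _; case: ifP.
- rewrite bigE !eqxx (eq_sym b a) (negbTE ab) (eq_sym c a) (negbTE ac).
  by rewrite (eq_sym c b) (negbTE bc) bary_sum.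
- rewrite bigE !eqxx (eq_sym b a) (negbTE ab) (eq_sym c a) (negbTE ac).
  by rewrite (eq_sym c b) (negbTE bc) -bary_comb.
Qed.

Lemma hull2P a b x : a != b ->
  hull [fset a; b]%fset x <-> exists2 t, 0 <= t <= 1 & x = a + t *: (b - a).
Proof.
move=> ab.
have bigE (V : nmodType) (F : pt R -> V) :
    \sum_(z <- [fset a; b]%fset) F z = F a + F b.
  by rewrite big_fsetU1 ?big_seq_fset1 // inE.
split.
  case=> w [w0]; rewrite !bigE => w1 xE.
  have wa : 0 <= w a by apply: w0; rewrite !inE eqxx.
  have wb : 0 <= w b by apply: w0; rewrite !inE eqxx orbT.
  exists (w b); first by rewrite wb -w1 lerDr.
  have waE : w a = 1 - w b by rewrite -w1 addrK.
  by rewrite xE waE !pairZ !pairD /=; congr (_, _); ring.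
case=> t /andP[t0 t1] xE; exists (fun z => if z == a then 1 - t else t); split.
- by move=> z _; case: ifP => // _; rewrite subr_ge0.
- by rewrite bigE eqxx eq_sym (negbTE ab) subrK.
- rewrite bigE eqxx eq_sym (negbTE ab) xE !pairZ !pairD /=.
  by congr (_, _); ring.
Qed.

Lemma hull_vertex K z : z \in K -> hull K z.
Proof.
move=> zK; exists (fun y => (y == z)%:R); split => [y _||].
- by rewrite ler0n.
- rewrite (big_fsetD1 z) //= eqxx big1_fset ?addr0 // => y.
  by rewrite !inE => /andP[/negbTE ->].
- rewrite (big_fsetD1 z) //= eqxx scale1r big1_fset ?addr0 // => y.
  by rewrite !inE => /andP[/negbTE -> _ _]; rewrite scale0r.
Qed.

Lemma hull_convex K x y s t : 0 <= s -> 0 <= t -> s + t = 1 ->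
  hull K x -> hull K y -> hull K (s *: x + t *: y).
Proof.
move=> s0 t0 st [w [w0 w1 xE]] [u [u0 u1 yE]].
exists (fun z => s * w z + t * u z); split.
- by move=> z zK; rewrite addr_ge0 // mulr_ge0 ?w0 ?u0.
- by rewrite big_split /= -!big_distrr /= w1 u1 !mulr1.
- rewrite xE yE !scaler_sumr -big_split /=; apply: eq_bigr => z _.
  by rewrite scalerDl !scalerA.
Qed.

Lemma fset3_perm a b c : [fset b; c; a]%fset = [fset a; b; c]%fset :> cell R.
Proof. by apply/fsetP => z; rewrite !inE; case: (z == a); case: (z == b); case: (z == c). Qed.

Lemma triangle_vertex K z : is_triangle K -> z \in K ->
  exists b c, K = [fset z; b; c]%fset /\ det3 z b c != 0.
Proof.
case=> a [b] [c] [-> h]; rewrite !inE -orbA => /or3P[] /eqP ->.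
- by exists b, c.
- by exists c, a; rewrite (fset3_perm a b c) (det3_rot a b c).
- by exists a, b; rewrite (fset3_perm c a b) -(det3_rot c a b).
Qed.

Lemma card_triangle K : is_triangle K -> #|` K|%fset = 3%N.
Proof.
case=> a [b] [c] [-> h]; have [ab bc ac] := det3_neq0 h.
rewrite fsetUC cardfsU1 cardfs2 ab !inE negb_or.
by rewrite (eq_sym c a) ac (eq_sym c b) bc.
Qed.

Lemma edgeP K z0 z1 : is_triangle K -> [fset z0; z1]%fset \in edges K <->
  z0 != z1 /\ exists c, K = [fset z0; z1; c]%fset /\ det3 z0 z1 c != 0.
Proof.
move=> tK; rewrite /edges !inE /= fpowersetE; split.
  rewrite cardfs2 => /andP[sub]; case: (boolP (z0 == z1)) => [//|z01 _].
  split => //.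
  have z0K : z0 \in K by apply: (fsubsetP sub); rewrite !inE eqxx.
  have [b [c [KE h]]] := triangle_vertex tK z0K.
  have : z1 \in K by apply: (fsubsetP sub); rewrite !inE eqxx orbT.
  rewrite KE !inE -orbA eq_sym (negbTE z01) /= => /orP[] /eqP ->.
    by exists c.
  exists b; rewrite fsetUAC; split => //.
  by rewrite -(det3_rot z0 c b) det3_swap (det3_rot z0 b c) oppr_eq0.
case=> z01 [c [-> h]]; rewrite cardfs2 z01 eqxx andbT.
by apply/fsubsetP => z; rewrite !inE => /orP[] ->; rewrite ?orbT.
Qed.

Lemma edge_sub_triangle K E : E \in edges K -> (E `<=` K)%fset.
Proof. by rewrite /edges !inE /= fpowersetE => /andP[]. Qed.

Lemma card_edge K E : E \in edges K -> #|` E|%fset = 2.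
Proof. by rewrite /edges !inE /= => /andP[_ /eqP]. Qed.

Lemma edge_pair K E : E \in edges K -> exists z0 z1, E = [fset z0; z1]%fset /\ z0 != z1.
Proof.
move=> /card_edge; have := fset_uniq E.
case eqE: (enum_fset E) => [|z0 [|z1 [|? ?]]] //= /andP[ne _] _.
exists z0, z1; split; last by move: ne; rewrite inE.
by apply/fsetP => z; rewrite -[LHS]/(z \in enum_fset E) eqE !inE.
Qed.

Lemma hull_sub E K : (E `<=` K)%fset -> hull E `<=` hull K.
Proof.
move=> EK x [w [w0 w1 xE]]; exists (fun z => if z \in E then w z else 0).
have bigE (V : nmodType) (F : pt R -> V) : (forall z, z \notin E -> F z = 0) ->
    \sum_(z <- K) F z = \sum_(z <- E) F z.
  move=> F0; rewrite (big_fsetID _ (mem E)) /= [X in _ + X]big1_fset ?addr0.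
    congr (\sum_(z <- _) _); congr enum_fset; apply/fsetP => z.
    by rewrite !inE /= andbC; case: (boolP (z \in E)) => // /(fsubsetP EK) ->.
  by move=> z; rewrite !inE => /andP[_ zE] _; exact: F0.
split.
- by move=> z _; case: ifP => // /w0.
- rewrite bigE => [|z /negbTE -> //]; rewrite -[RHS]w1; apply: eq_big_seq => z.
  by move=> ->.
- rewrite bigE => [|z /negbTE ->]; last by rewrite scale0r.
  by rewrite xE; apply: eq_big_seq => z ->.
Qed.

Lemma hull_vertex_eq a b c x : det3 a b c != 0 -> hull [fset a; b; c]%fset x ->
  1 <= bary a b c x -> x = a.
Proof.
move=> h /hull3P -/(_ h)[ha hb hc] h1.
have s := bary_sum x h.
have e1 : bary a b c x = 1 by lra.
have e2 : bary b c a x = 0 by lra.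
have e3 : bary c a b x = 0 by lra.
by rewrite (bary_comb x h) e1 e2 e3 scale1r !scale0r !addr0.
Qed.

Lemma midpointE a b : midpoint a b = 2^-1 *: a + 2^-1 *: b.
Proof. by rewrite /midpoint scalerDr. Qed.

Lemma half_sum : 2^-1 + 2^-1 = 1 :> R. Proof. by lra. Qed.

(** A vertex is an extreme point: its own coordinate equals 1 there and is the average of the
    coordinates of [x] and [y], which are at most 1, so both points would be that vertex. *)
Lemma midpoint_not_vertex K x y : is_triangle K -> hull K x -> hull K y ->
  x != y -> midpoint x y \notin K.
Proof.
move=> tK hx hy; apply: contra => mK.
have [b [c [KE h]]] := triangle_vertex tK mK; move: hx hy; rewrite KE => hx hy.
have [hx1 hx2 hx3] := (hull3P x h).1 hx; have [hy1 hy2 hy3] := (hull3P y h).1 hy.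
have [m1 _ _] := bary_id h.
have := m1; rewrite {2}midpointE bary_affine ?half_sum // => m2.
have sx := bary_sum x h; have sy := bary_sum y h.
apply/eqP; transitivity (midpoint x y).
  by apply: (hull_vertex_eq h hx); lra.
by apply/esym/(hull_vertex_eq h hy); lra.
Qed.

Lemma midpoint_hull K x y : hull K x -> hull K y -> hull K (midpoint x y).
Proof. by move=> hx hy; rewrite midpointE; apply: hull_convex => //; lra. Qed.

Lemma hull_min K a b c : det3 a b c != 0 ->
  hull K a -> hull K b -> hull K c -> hull [fset a; b; c]%fset `<=` hull K.
Proof.
move=> h ha hb hc u /hull3P -/(_ h)[ua ub uc].
have s := bary_sum u h.
rewrite (bary_comb u h).
(* If the weight of [c] is 1, the point is [c]; otherwise it lies between [c] and the point of the
   segment from [a] to [b] given by the two other weights, normalised. *)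
have [e|ne] := eqVneq (bary c a b u) 1.
  have -> : bary a b c u = 0 by lra.
  have -> : bary b c a u = 0 by lra.
  by rewrite e !scale0r !add0r scale1r.
have pos : 0 < bary a b c u + bary b c a u.
  by rewrite lt_neqAle addr_ge0 // andbT; apply/eqP => e; move/eqP: ne; apply; lra.
set p := bary a b c u in s ua pos *; set q := bary b c a u in s ub pos *.
have -> : p *: a + q *: b = (p + q) *: (p / (p + q) *: a + q / (p + q) *: b).
  by rewrite scalerDr !scalerA !(mulrCA (p + q)) divff ?mulr1 // gt_eqF.
apply: hull_convex => //; first exact: ltW.
apply: hull_convex ha hb.
- exact: divr_ge0 ua (ltW pos).
- exact: divr_ge0 ub (ltW pos).
- by rewrite -mulrDl divff // gt_eqF.
Qed.

End PlaneGeometry.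
(** * Conforming meshes *)

Section Sides.
Context {R : realType}.
Implicit Types (a b c d x y z u w : pt R) (K E : cell R) (s t : R).
Implicit Types (T : {fset cell R}) (Omega : set (pt R)).

Lemma dot_rot90_sqr z0 z1 : z0 != z1 ->
  0 < dot (rot90 (z1 - z0)) (rot90 (z1 - z0)).
Proof.
case: z0 z1 => [p q] [p' q'] ne; rewrite /dot /rot90 /=.
rewrite mulrNN -!expr2; rewrite lt_neqAle addr_ge0 ?sqr_ge0 // andbT eq_sym.
rewrite paddr_eq0 ?sqr_ge0 // !sqrf_eq0 !subr_eq0.
by apply: contra ne => /andP[/eqP-> /eqP->].
Qed.

Lemma near_pos (p q : R) : 0 < p -> \forall e \near 0^'+, 0 < p + e * q.
Proof.
move=> p0; near=> e.
have e0 : 0 < e by [].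
have eq1 : e * (`|q| + 1) < p.
  by rewrite -ltr_pdivlMr ?ltr_wpDl //; near: e; apply: nbhs_right_lt; rewrite divr_gt0 ?ltr_wpDl.
have h : - `|q| <= q by rewrite lerNl -normrN ler_norm.
have : 0 <= e * (q + `|q|) by apply: mulr_ge0; lra.
lra.
Unshelve. all: by end_near. Qed.

Definition seg z0 z1 t : pt R := z0 + t *: (z1 - z0).

Lemma det3_seg z0 z1 t : det3 z0 z1 (seg z0 z1 t) = 0.
Proof. by rewrite det3E /seg !pairZ /=; ring. Qed.

Lemma bary_seg z0 z1 c t : det3 z0 z1 c != 0 ->
  [/\ bary z0 z1 c (seg z0 z1 t) = 1 - t, bary z1 c z0 (seg z0 z1 t) = t
    & bary c z0 z1 (seg z0 z1 t) = 0].
Proof.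
move=> h; have -> : seg z0 z1 t = (1 - t) *: z0 + t *: z1 + 0 *: c.
  by rewrite /seg !pairZ !pairD /=; congr (_, _); ring.
by apply: bary_unique => //; ring.
Qed.

Lemma bary_ray a b c x d s :
  bary a b c (x + s *: d) = bary a b c x + s * (dot (rot90 (c - b)) d / det3 a b c).
Proof. by rewrite !baryE det3_ray mulrDl mulrA. Qed.

Lemma det3_bary z0 z1 c x : det3 z0 z1 c != 0 ->
  det3 z0 z1 x = bary c z0 z1 x * det3 z0 z1 c.
Proof. by move=> h; rewrite baryE (det3_rot c z0 z1) divfK // -(det3_rot c z0 z1). Qed.

Lemma divr_ge0_mul (p q : R) : 0 < p * q -> 0 <= p / q.
Proof.
move=> pq; have q0 : q != 0 by apply: contraTneq pq => ->; rewrite mulr0 ltxx.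
have -> : p / q = p * q / q ^+ 2 by field.
by rewrite divr_ge0 ?sqr_ge0 ?ltW.
Qed.

(** At an inner point of the edge two coordinates are positive and stay so nearby; the third starts
    at 0 and grows along [d], which points to the side of [c]. *)
Lemma near_in_hull z0 z1 c t d : det3 z0 z1 c != 0 -> 0 < t < 1 ->
  0 < dot (rot90 (z1 - z0)) d * det3 z0 z1 c ->
  \forall e \near 0^'+, hull [fset z0; z1; c]%fset (seg z0 z1 t + e *: d).
Proof.
move=> h /andP[t0 t1] hd; have [b0 b1 b2] := bary_seg t h.
near=> e; have e0 : 0 < e by [].
apply/(hull3P _ h); rewrite !(bary_ray _ _ _ (seg z0 z1 t)) b0 b1 b2; split.
- by apply: ltW; near: e; apply: near_pos; lra.
- by apply: ltW; near: e; exact: near_pos.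
- by rewrite add0r mulr_ge0 ?(ltW e0) // -(det3_rot c z0 z1) divr_ge0_mul.
Unshelve. all: by end_near. Qed.

Lemma hull_det3_sign z0 z1 c x : det3 z0 z1 c != 0 ->
  hull [fset z0; z1; c]%fset x -> 0 <= det3 z0 z1 x * det3 z0 z1 c.
Proof.
move=> h /(hull3P _ h)[_ _ hc]; rewrite (det3_bary x h) -mulrA -expr2.
by rewrite mulr_ge0 ?sqr_ge0.
Qed.

(** Encoded on the vertex set: for a triangle with the edge [z0], [z1] only the third vertex has a
    nonzero determinant, so this is the side of the oriented edge on which the triangle lies. *)
Definition side z0 z1 K : bool := has (fun c => 0 < det3 z0 z1 c) K.

Lemma sideE z0 z1 c : side z0 z1 [fset z0; z1; c]%fset = (0 < det3 z0 z1 c).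
Proof.
have d0 : det3 z0 z1 z0 = 0 by rewrite det3E; ring.
have d1 : det3 z0 z1 z1 = 0 by rewrite det3E; ring.
apply/hasP/idP => [[y]|h]; last by exists c => //; rewrite !inE eqxx orbT.
by rewrite !inE -orbA => /or3P[] /eqP -> //; rewrite ?d0 ?d1 ltxx.
Qed.

(** The coordinate at the vertex opposite to [E] vanishes at an inner point of the segment and is
    nonnegative at both ends, hence vanishes at both; this leaves only the ends of [E]. *)
Lemma edge_eq_of_seg K E z0 z1 t : is_triangle K -> E \in edges K ->
  z0 != z1 -> z0 \in K -> z1 \in K ->
  0 < t < 1 -> hull E (seg z0 z1 t) -> E = [fset z0; z1]%fset.
Proof.
move=> tK EK z01 z0K z1K /andP[t0 t1].
have [u [w [EE uw]]] := edge_pair EK; move: EK; rewrite {}EE.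
move=> /(edgeP _ _ tK)[_ [c [KE h]]] /(hull2P _ uw)[s s01 xE].
have hx : bary c u w (seg z0 z1 t) = 0 by rewrite xE; have [] := bary_seg s h.
have := hull_vertex z0K; have := hull_vertex z1K.
rewrite KE => /(hull3P _ h)[_ _ h1] /(hull3P _ h)[_ _ h0].
have segE : seg z0 z1 t = (1 - t) *: z0 + t *: z1.
  by rewrite /seg !pairZ !pairD /=; congr (_, _); ring.
move: hx; rewrite segE bary_affine ?subrK // => hx.
have t1' : 0 < 1 - t by lra.
have e0 : bary c u w z0 = 0 by nra.
have e1 : bary c u w z1 = 0 by nra.
have [bc _ _] : [/\ bary c u w c = 1, bary c u w u = 0 & bary c u w w = 0].
  by apply: bary_id; rewrite -(det3_rot c u w).
have mem z : z \in K -> bary c u w z = 0 -> z \in [fset u; w]%fset.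
  rewrite KE !inE -orbA => /or3P[] /eqP -> bz; rewrite ?eqxx ?orbT //.
  by move: bz; rewrite bc => /eqP; rewrite oner_eq0.
apply/esym/eqP; rewrite eqEfcard !cardfs2 uw z01 leqnn andbT.
apply/fsubsetP => z; rewrite !inE => /orP[] /eqP ->.
  by have := mem _ z0K e0; rewrite !inE.
by have := mem _ z1K e1; rewrite !inE.
Qed.

Section Conforming.
Variable T : {fset cell R}.
Hypothesis triT : forall K, K \in T -> is_triangle K.
Hypothesis confT : conforming T.

(** Conformity in the form used below: an inner point of an edge of [K] is not a vertex of [K], so
    among the three possible intersections only the common edge remains. *)
Lemma common_edge K K' z0 z1 t : K \in T -> K' \in T -> K != K' ->
  [fset z0; z1]%fset \in edges K -> 0 < t < 1 -> hull K' (seg z0 z1 t) ->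
  [fset z0; z1]%fset \in edges K' /\
  hull K `&` hull K' = hull [fset z0; z1]%fset.
Proof.
move=> KT K'T KK' EK t01 hK'.
have [z01 [c [KE h]]] := (edgeP _ _ (triT KT)).1 EK.
have [b0 b1 b2] := bary_seg t h.
have hK : hull K (seg z0 z1 t).
  by rewrite KE; apply/(hull3P _ h); rewrite b0 b1 b2; split; lra.
have [z0K z1K] : z0 \in K /\ z1 \in K by rewrite KE !inE !eqxx ?orbT.
have xK : seg z0 z1 t \notin K.
  have hc : det3 c z0 z1 != 0 by rewrite -(det3_rot c z0 z1).
  have hz1 : det3 z1 c z0 != 0 by rewrite (det3_rot z0 z1 c).
  rewrite KE !inE; apply/negP => /orP[/orP[]|] /eqP xE.
  - by move: b0; rewrite xE; have [-> _ _] := bary_id h; lra.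
  - by move: b1; rewrite xE; have [-> _ _] := bary_id hz1; lra.
  - by move: b2; rewrite xE; have [-> _ _] := bary_id hc; lra.
case: (confT KT K'T KK') => [e|[z [zK _ e]]|[E [EK1 EK' e]]].
- have : (hull K `&` hull K') (seg z0 z1 t) by [].
  by rewrite e.
- have : (hull K `&` hull K') (seg z0 z1 t) by [].
  by rewrite e => /= xz; move: xK; rewrite xz zK.
- have xE : hull E (seg z0 z1 t) by rewrite -e.
  have EE := edge_eq_of_seg (triT KT) EK1 z01 z0K z1K t01 xE.
  by rewrite -EE.
Qed.

(** Two distinct triangles on one side of a common edge would overlap just off its midpoint, whereas
    conformity leaves only the edge in common. *)
Lemma same_side K K' z0 z1 : K \in T -> K' \in T ->
  [fset z0; z1]%fset \in edges K -> [fset z0; z1]%fset \in edges K' ->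
  side z0 z1 K = side z0 z1 K' -> K = K'.
Proof.
move=> KT K'T EK EK'; case: (eqVneq K K') => // KK' sd; exfalso.
have [z01 [c [KE h]]] := (edgeP _ _ (triT KT)).1 EK.
have [_ [c' [KE' h']]] := (edgeP _ _ (triT K'T)).1 EK'.
have t01 : 0 < (2^-1 : R) < 1 by lra.
have [b0 b1 b2] := bary_seg 2^-1 h'.
have hK' : hull K' (seg z0 z1 2^-1).
  by rewrite KE'; apply/(hull3P _ h'); rewrite b0 b1 b2; split; lra.
have [_ e] := common_edge KT K'T KK' EK t01 hK'.
have sgn : 0 < det3 z0 z1 c * det3 z0 z1 c'.
  move: sd; rewrite KE KE' !sideE; move: h h'.
  rewrite !neq_lt => /orP[p|p] /orP[q|q].
  - by rewrite nmulr_rgt0.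
  - by rewrite q ltNge (ltW p).
  - by rewrite p ltNge (ltW q).
  - by rewrite mulr_gt0.
have dd := dot_rot90_sqr z01.
pose d : pt R := det3 z0 z1 c *: rot90 (z1 - z0).
have dE : dot (rot90 (z1 - z0)) d =
    det3 z0 z1 c * dot (rot90 (z1 - z0)) (rot90 (z1 - z0)).
  by rewrite /d /dot !pairZ /=; ring.
have n1 : \forall e \near 0^'+, hull K (seg z0 z1 2^-1 + e *: d).
  rewrite KE; apply: near_in_hull => //; rewrite dE mulrAC mulr_gt0 //.
  by rewrite -expr2 lt_neqAle sqr_ge0 andbT eq_sym sqrf_eq0.
have n2 : \forall e \near 0^'+, hull K' (seg z0 z1 2^-1 + e *: d).
  by rewrite KE'; apply: near_in_hull => //; rewrite dE mulrAC mulr_gt0.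
have : \forall e \near (0:R)^'+, False.
  near=> s; have s0 : 0 < s by [].
  have : (hull K `&` hull K') (seg z0 z1 2^-1 + s *: d).
    by split; near: s.
  rewrite e => /(hull2P _ z01)[t _ tE].
  have := det3_seg z0 z1 t; rewrite /seg -tE det3_ray det3_seg add0r dE.
  by apply/eqP; rewrite !mulf_neq0 // gt_eqF.
by move=> /filter_ex[].
Unshelve. all: by end_near. Qed.


Lemma edge_of_subhull K K' E : K \in T -> K' \in T -> E \in edges K ->
  hull E `<=` hull K' -> E \in edges K'.
Proof.
move=> KT K'T EK EK'; case: (eqVneq K K') => [<- //|KK'].
have [z0 [z1 [EE z01]]] := edge_pair EK; move: EK EK'; rewrite {}EE => EK EK'.
have t01 : 0 < (2^-1 : R) < 1 by lra.
have xE : hull [fset z0; z1]%fset (seg z0 z1 2^-1).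
  by apply/(hull2P _ z01); exists 2^-1 => //; lra.
by have [] := common_edge KT K'T KK' EK t01 (EK' _ xE).
Qed.

Lemma interior_ray (A : set (pt R)) x d : interior A x ->
  \forall e \near 0^'+, A (x + e *: d).
Proof.
move=> Ax; have cts : (fun e : R => x + e *: d) @ 0^'+ --> x.
  apply: cvg_at_right_filter; rewrite -[X in _ --> X]addr0 -(scale0r d).
  by apply: cvgD; [exact: cvg_cst|apply: cvgZl; exact: cvg_id].
exact: cts.
Qed.

(** The intersection of two distinct triangles lies in a line, and an interior point can be moved
    off any line. *)
Lemma interior_unique K K' x : K \in T -> K' \in T ->
  interior (hull K) x -> interior (hull K') x -> K = K'.
Proof.
move=> KT K'T xK xK'; case: (eqVneq K K') => // KK'; exfalso.
suff [u [w [uw sub]]] : exists u w : pt R, u != w /\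
    forall y, hull K y -> hull K' y -> det3 u w y = 0.
  have dd := dot_rot90_sqr uw.
  have : \forall e \near (0:R)^'+, False.
    near=> s; have s0 : 0 < s by [].
    have h : det3 u w (x + s *: rot90 (w - u)) = 0.
      by apply: sub; near: s; apply: interior_ray.
    move: h; rewrite det3_ray sub ?add0r; try exact: interior_subset.
    by apply/eqP; rewrite gt_eqF ?mulr_gt0.
  by move=> /filter_ex[].
case: (confT KT K'T KK') => [e|[z [zK _ e]]|[E [EK1 _ e]]].
- exists 0, (1, 0); split; first by apply/eqP => -[] /esym/eqP; rewrite oner_eq0.
  by move=> y y1 y2; have : (hull K `&` hull K') y by []; rewrite e.
- exists z, (z + (1, 0)); split.
    by rewrite eq_sym -subr_eq0 addrC addKr; apply/eqP => -[] /eqP; rewrite oner_eq0.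
  move=> y y1 y2; have : (hull K `&` hull K') y by [].
  by rewrite e => /= ->; rewrite det3E; ring.
- have [u [w [EE uw]]] := edge_pair EK1; exists u, w; split => // y y1 y2.
  have : (hull K `&` hull K') y by [].
  by rewrite e EE => /(hull2P _ uw)[t _ ->]; exact: det3_seg.
Unshelve. all: by end_near. Qed.

End Conforming.
End Sides.
(** * Meshes of a Lipschitz domain *)

Section Domain.
Context {R : realType}.
Implicit Types (a b c d x y z u w : pt R) (K E : cell R) (s t : R).
Implicit Types (T : {fset cell R}) (Omega : set (pt R)).

Lemma affine_continuous (p q r : R) : continuous (fun y : pt R => p + q * y.1 + r * y.2).
Proof.
move=> x; apply: cvgD; first apply: cvgD; first exact: cvg_cst.
  by apply: cvgMr; exact: cvg_fst.
by apply: cvgMr; exact: cvg_snd.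
Qed.

Lemma bary_near_pos a b c x : 0 < bary a b c x ->
  \forall y \near x, 0 < bary a b c y.
Proof.
pose D := det3 a b c.
have eq y : bary a b c y =
    (- (c.1 - b.1) * b.2 + (c.2 - b.2) * b.1) / D
    + (- (c.2 - b.2) / D) * y.1 + ((c.1 - b.1) / D) * y.2.
  by rewrite baryE det3E -/D; ring.
move=> h; apply: (@cvgr_gt _ _ (nbhs x) _ (bary a b c)) h.
rewrite (funext eq); exact: affine_continuous.
Qed.

(** This excludes slits. As [x] is not in [Omega], [g 0 >= 0], and the Lipschitz bound keeps the
    graph above a cone opening downwards from [x]; a point slightly below [x] is therefore at
    positive distance from [Omega]. *)
Lemma lipschitz_boundary_exterior Omega x : open Omega ->
  lipschitz_boundary Omega -> boundary Omega x -> ~ interior (closure Omega) x.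
Proof.
move=> oO lip bx ix.
have nOx : ~ Omega x by case: bx => _; rewrite (interior_id _).1.
have [e [r [h [L [g [e1 r0 h0 gL gE]]]]]] := lip x bx.
have ee : e.1 * e.1 + e.2 * e.2 = 1.
  have d0 : 0 <= dot e e by rewrite /dot -!expr2 addr_ge0 ?sqr_ge0.
  by rewrite -[LHS]/(dot e e) -(sqr_sqrtr d0) -[Num.sqrt _]/(enorm e) e1 expr1n.
have L0 : 0 <= L.
  by have := gL 1 0; rewrite subr0 normr1 mulr1; apply: le_trans.
have g0 : 0 <= g 0.
  rewrite leNgt; apply/negP => gneg; apply: nOx.
  have := (gE 0 0); rewrite !normr0 => /(_ r0 h0)[_ /(_ gneg)].
  by rewrite !scale0r !addr0.
have : \forall tau \near (0:R)^'+, False.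
  near=> tau; have t0 : 0 < tau by [].
  have yO : closure Omega (x + tau *: - rot90 e).
    by near: tau; exact: interior_ray.
  (* Within [del] of depth [tau] in both local coordinates the graph is still higher:
     [- L * del > - tau + del], since [(L + 1) * del = tau / 2]. *)
  pose del := tau / (2 * (L + 1)).
  have del0 : 0 < del by rewrite divr_gt0 // mulr_gt0 //; lra.
  have delE : (L + 1) * del = tau / 2 by rewrite /del; field; lra.
  have del20 : 0 < del / 2 by lra.
  have [w [Ow [/= b1 b2]]] := yO _ (nbhsx_ballx (x + tau *: - rot90 e) _ del20).
  pose u : pt R := (w.1 - (x.1 + tau * e.2), w.2 - (x.2 - tau * e.1)).
  have u1 : `|u.1| < del / 2.
    have b1' : `|x.1 + tau * - - e.2 - w.1| < del / 2 by [].
    by rewrite distrC; apply: le_lt_trans b1'; rewrite opprK.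
  have u2 : `|u.2| < del / 2.
    have b2' : `|x.2 + tau * - e.1 - w.2| < del / 2 by [].
    by rewrite distrC; apply: le_lt_trans b2'; rewrite mulrN.
  have [ea eb] : `|e.1| <= 1 /\ `|e.2| <= 1.
    by rewrite !ler_norml; split; apply/andP; split; nra.
  have du (v1 v2 : R) : `|v1| <= 1 -> `|v2| <= 1 -> `|u.1 * v1 + u.2 * v2| <= del.
    move=> h1 h2; apply: le_trans (ler_normD _ _) _; rewrite !normrM.
    have n1 := normr_ge0 u.1; have n2 := normr_ge0 u.2.
    have n3 := normr_ge0 v1; have n4 := normr_ge0 v2.
    nra.
  pose s := u.1 * e.1 + u.2 * e.2.
  pose t := - tau + (u.1 * - e.2 + u.2 * e.1).
  have sd : `|s| <= del by exact: du.
  have td : `|u.1 * - e.2 + u.2 * e.1| <= del by apply: du; rewrite ?normrN.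
  have wE : w = x + s *: e + t *: rot90 e.
    rewrite [w]surjective_pairing [x]surjective_pairing !pairZ !pairD /=.
    congr (_, _); rewrite /s /t /u /=.
      transitivity (x.1 + tau * e.2
        + (w.1 - (x.1 + tau * e.2)) * (e.1 * e.1 + e.2 * e.2)); last by ring.
      by rewrite ee; ring.
    transitivity (x.2 - tau * e.1
      + (w.2 - (x.2 - tau * e.1)) * (e.1 * e.1 + e.2 * e.2)); last by ring.
    by rewrite ee; ring.
  have tr : tau < r by near: tau; exact: nbhs_right_lt.
  have th : tau < h / 2 by near: tau; apply: nbhs_right_lt; rewrite divr_gt0.
  have dt : del <= tau / 2 by nra.
  move: td; rewrite ler_norml => /andP[td1 td2].
  have sr : `|s| < r by lra.
  have tlt : `|t| < h by rewrite ltr_norml /t; apply/andP; split; lra.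
  have /(gE _ _ sr tlt) gs : Omega (x + s *: e + t *: rot90 e) by rewrite -wE.
  have := gL s 0; rewrite subr0 => gs0.
  have := ler_norm (- (g s - g 0)); rewrite normrN => gs1.
  have Ls : L * `|s| <= L * del by rewrite ler_wpM2l.
  by move: gs; rewrite /t; apply/negP; rewrite -leNgt; lra.
by move=> /filter_ex[].
Unshelve. all: by end_near. Qed.

Lemma interior_closure_domain Omega : polygonal_lipschitz_domain Omega ->
  interior (closure Omega) `<=` Omega.
Proof.
case=> oO _ _ _ [_ lip] y iy; apply: contrapT => nOy.
apply: (lipschitz_boundary_exterior oO lip _ iy); split.
  exact: (interior_subset iy).
by rewrite (interior_id _).1.
Qed.

Lemma boundary_not_interior Omega x : polygonal_lipschitz_domain Omega ->
  boundary Omega x -> ~ interior (closure Omega) x.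
Proof. by case=> oO _ _ _ [_ lip]; apply: lipschitz_boundary_exterior. Qed.

Lemma near_not_hull K x d : is_triangle K -> ~ hull K x ->
  \forall e \near 0^'+, ~ hull K (x + e *: d).
Proof.
move=> [a [b [c [-> h]]]] nx.
have out p q r : (bary p q r x < 0) ->
    \forall e \near 0^'+, bary p q r (x + e *: d) < 0.
  move=> neg; have neg' : 0 < - bary p q r x by rewrite oppr_gt0.
  apply: filterS (near_pos (- (dot (rot90 (r - q)) d / det3 p q r)) neg') => e.
  by rewrite bary_ray mulrN -opprD oppr_gt0.
have : [\/ bary a b c x < 0, bary b c a x < 0 | bary c a b x < 0].
  rewrite !ltNge; case: (boolP (0 <= bary a b c x)) => h1; last by constructor 1.
  case: (boolP (0 <= bary b c a x)) => h2; last by constructor 2.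
  case: (boolP (0 <= bary c a b x)) => h3; last by constructor 3.
  by case: nx; apply/(hull3P _ h).
case=> /out o; near=> e; move/(hull3P _ h) => [h1 h2 h3];
  [move: h1|move: h2|move: h3]; apply/negP; rewrite -ltNge; near: e; exact: o.
Unshelve. all: by end_near. Qed.

Lemma near_all_seq (I : eqType) (F : set_system R) (FF : Filter F)
    (r : seq I) (P : I -> R -> Prop) :
  (forall i, i \in r -> \forall e \near F, P i e) ->
  \forall e \near F, forall i, i \in r -> P i e.
Proof.
elim: r => [_|i r IH h]; first exact: nearW.
have h1 := h i (mem_head _ _).
have h2 : \forall e \near F, forall j, j \in r -> P j e.
  by apply: IH => j jr; apply: h; rewrite inE jr orbT.
near=> e => j; rewrite inE => /orP[/eqP ->|]; first by near: e.
by move: j; near: e.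
Unshelve. all: by end_near. Qed.

Section Mesh.
Variables (Omega : set (pt R)) (T : {fset cell R}).
Hypothesis domO : polygonal_lipschitz_domain Omega.
Hypothesis triT : triangulation Omega T.

Let tri K : K \in T -> is_triangle K. Proof. by case: triT => h _ _; exact: h. Qed.
Let conf : conforming T. Proof. by case: triT. Qed.

Lemma hull_closure K : K \in T -> hull K `<=` closure Omega.
Proof. by case: triT => _ <- _ KT x Kx; exists K. Qed.

Lemma interior_hull_domain K : K \in T -> interior (hull K) `<=` Omega.
Proof.
move=> KT x ix; apply: (interior_closure_domain domO).
by apply: filterS ix; exact: hull_closure.
Qed.

(** A step off the edge away from [K] stays in the open set [Omega], so it ends in some triangle;
    for a short step this triangle also contains the starting point, and conformity makes the edge
    common. *)
Lemma interior_edge_neighbour K z0 z1 : K \in T ->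
  [fset z0; z1]%fset \in edges K -> ~ boundary_edge Omega [fset z0; z1]%fset ->
  exists K', [/\ K' \in T, [fset z0; z1]%fset \in edges K' &
    side z0 z1 K' = ~~ side z0 z1 K].
Proof.
move=> KT EK nb; have oO : open Omega by case: domO.
have [z01 [c [KE h]]] := (edgeP _ _ (tri KT)).1 EK.
have [x xE nbx] : exists2 x, hull [fset z0; z1]%fset x & ~ boundary Omega x.
  apply: contrapT => hn; apply: nb => x xE; apply: contrapT => nx.
  by apply: hn; exists x.
have xcl : closure Omega x.
  by apply: hull_closure KT _ _; exact: hull_sub (edge_sub_triangle EK) _ xE.
have xi : interior Omega x by apply: contrapT => ni; apply: nbx.
have [t t01 xt] := (hull2P _ z01).1 xE.
(* The point of [Omega] found on the edge may be an endpoint; moving it slightly towards the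
   midpoint gives an inner point. *)
have [t' [t'01 Ot']] : exists t', 0 < t' < 1 /\ Omega (seg z0 z1 t').
  have := interior_ray ((2^-1 - t) *: (z1 - z0)) xi.
  move=> ray; have : \forall e \near (0:R)^'+, exists t', 0 < t' < 1 /\ Omega (seg z0 z1 t').
    near=> e; have e0 : 0 < e by [].
    have e1 : e < 1 by near: e; exact: nbhs_right_lt.
    exists (t + e * (2^-1 - t)); split; first by nra.
    have -> : seg z0 z1 (t + e * (2^-1 - t)) = x + e *: ((2^-1 - t) *: (z1 - z0)).
      by rewrite xt /seg !pairZ !pairD /=; congr (_, _); ring.
    by near: e.
  by move=> /filter_ex[_ ?].
have it' : interior Omega (seg z0 z1 t') by rewrite (interior_id _).1.
have dd := dot_rot90_sqr z01.
pose d : pt R := (- det3 z0 z1 c) *: rot90 (z1 - z0).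
have dE : dot (rot90 (z1 - z0)) d =
    - det3 z0 z1 c * dot (rot90 (z1 - z0)) (rot90 (z1 - z0)).
  by rewrite /d /dot !pairZ /=; ring.
have hh : 0 < det3 z0 z1 c * det3 z0 z1 c.
  by rewrite -expr2 lt_neqAle sqr_ge0 andbT eq_sym sqrf_eq0.
(* Since the mesh is finite, one bound on the step length works for all triangles: one reached after
   the step already contains the starting point. *)
have far : \forall e \near 0^'+, forall K', K' \in enum_fset T ->
    hull K' (seg z0 z1 t') \/ ~ hull K' (seg z0 z1 t' + e *: d).
  apply: near_all_seq => K' K'T.
  have [hK'|nK'] := pselect (hull K' (seg z0 z1 t')); first by apply: nearW; left.
  by have := near_not_hull d (tri K'T) nK'; apply: filterS; right.
have /filter_ex[e [[e0 Oe] alle]] : \forall e \near 0^'+,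
    (0 < e /\ Omega (seg z0 z1 t' + e *: d)) /\
    forall K', K' \in enum_fset T ->
    hull K' (seg z0 z1 t') \/ ~ hull K' (seg z0 z1 t' + e *: d).
  near=> e; split; last by near: e.
  by split => //; near: e; exact: interior_ray.
have : closure Omega (seg z0 z1 t' + e *: d) by exact: subset_closure.
case: (triT) => _ <- _ [K' /= K'T hK'e].
have hK' : hull K' (seg z0 z1 t') by case: (alle K' K'T).
have detx : det3 z0 z1 (seg z0 z1 t' + e *: d) = e * dot (rot90 (z1 - z0)) d.
  by rewrite det3_ray det3_seg add0r.
have KK' : K != K'.
  apply/eqP => KK'; move: hK'e; rewrite -KK' KE => /(hull_det3_sign h).
  rewrite detx dE; apply/negP; rewrite -ltNge.
  rewrite (_ : _ * _ = - (e * dot (rot90 (z1 - z0)) (rot90 (z1 - z0))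
    * (det3 z0 z1 c * det3 z0 z1 c))); last by ring.
  by rewrite oppr_lt0; apply: mulr_gt0 hh; exact: mulr_gt0.
have [EK' _] := common_edge tri conf KT K'T KK' EK t'01 hK'.
exists K'; split => //.
have [_ [c' [KE' h']]] := (edgeP _ _ (tri K'T)).1 EK'.
move: hK'e; rewrite KE' => /(hull_det3_sign h'); rewrite detx dE.
rewrite (_ : _ * _ = - (e * dot (rot90 (z1 - z0)) (rot90 (z1 - z0))
  * (det3 z0 z1 c * det3 z0 z1 c'))); last by ring.
rewrite oppr_ge0 pmulr_rle0 ?mulr_gt0 // KE !sideE.
move: h h'; rewrite !neq_lt => /orP[p|p] /orP[q|q] hle.
- by move: hle; rewrite leNgt nmulr_rgt0 // q.
- by rewrite q ltNge (ltW p).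
- by rewrite p ltNge (ltW q).
- by move: hle; rewrite leNgt mulr_gt0.
Unshelve. all: by end_near. Qed.

(** Triangles on opposite sides would together cover a neighbourhood of the midpoint, putting a
    boundary point into the interior of the closure of [Omega]. *)
Lemma boundary_edge_unique K K' z0 z1 : K \in T -> K' \in T ->
  [fset z0; z1]%fset \in edges K -> [fset z0; z1]%fset \in edges K' ->
  boundary_edge Omega [fset z0; z1]%fset -> K = K'.
Proof.
move=> KT K'T EK EK' bE; case: (boolP (side z0 z1 K == side z0 z1 K')) => [/eqP|sd].
  exact: (same_side tri conf KT K'T).
exfalso.
have [z01 [c [KE h]]] := (edgeP _ _ (tri KT)).1 EK.
have [_ [c' [KE' h']]] := (edgeP _ _ (tri K'T)).1 EK'.
have bm : boundary Omega (seg z0 z1 2^-1).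
  by apply: bE; apply/(hull2P _ z01); exists 2^-1 => //; lra.
apply: (boundary_not_interior domO bm).
have near01 c0 : det3 z0 z1 c0 != 0 -> \forall y \near seg z0 z1 2^-1,
    0 <= det3 z0 z1 y * det3 z0 z1 c0 -> hull [fset z0; z1; c0]%fset y.
  move=> h0; have [b0 b1 _] := bary_seg 2^-1 h0; near=> y => sg.
  apply/(hull3P _ h0); split.
  - by apply: ltW; near: y; apply: bary_near_pos; rewrite b0; lra.
  - by apply: ltW; near: y; apply: bary_near_pos; rewrite b1; lra.
  - move: sg; rewrite (det3_bary _ h0) -mulrA pmulr_lge0 //.
    by rewrite -expr2 lt_neqAle sqr_ge0 andbT eq_sym sqrf_eq0.
have n1 := near01 _ h; have n2 := near01 _ h'.
rewrite /interior /=; near=> y.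
have [s1|s1] := leP 0 (det3 z0 z1 y * det3 z0 z1 c).
  apply: (hull_closure KT); rewrite KE.
  by move: s1; near: y.
apply: (hull_closure K'T); rewrite KE'.
have s2 : 0 <= det3 z0 z1 y * det3 z0 z1 c'.
  move: sd s1; rewrite KE KE' !sideE.
  move: h h'; rewrite !neq_lt => /orP[p|p] /orP[q|q].
  - by rewrite !ltNge (ltW p) (ltW q).
  - by rewrite (nmulr_llt0 _ p) => _ s1; rewrite mulr_ge0 ?ltW.
  - by rewrite (pmulr_llt0 _ p) => _ s1; rewrite mulr_le0 ?ltW.
  - by rewrite p q.
by move: s2; near: y.
Unshelve. all: by end_near. Qed.

End Mesh.
End Domain.
(** * Newest vertex bisection *)

Section Bisection.
Context {R : realType}.
Implicit Types (a b c p x y z : pt R) (K E : cell R).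
Implicit Types (T : {fset cell R}).

(** [is_triangle] only provides some enumeration of the vertices; this transfers nondegeneracy to
    the one at hand. *)
Lemma triangle_det3 a b c : is_triangle [fset a; b; c]%fset -> det3 a b c != 0.
Proof.
move=> tK; have ab : a != b.
  apply/eqP => ab; have := card_triangle tK; rewrite ab fsetUid cardfs2.
  by case: (_ != _).
have : [fset a; b]%fset \in edges [fset a; b; c]%fset.
  rewrite /edges !inE /= fpowersetE cardfs2 ab eqxx andbT.
  by apply/fsubsetP => z; rewrite !inE => ->.
move=> /(edgeP _ _ tK)[_ [c' [e h]]].
have : c' \in [fset a; b; c]%fset by rewrite e !inE eqxx orbT.
rewrite !inE -orbA => /or3P[] /eqP cE; move: h; rewrite cE //.
  by rewrite det3E; move/eqP; case; ring.
by rewrite det3E; move/eqP; case; ring.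
Qed.

Definition half_of K K' := exists p a b,
  K' = [fset p; a; b]%fset /\ K = [fset p; a; midpoint a b]%fset.

(* The last case covers two or more bisections: since the newest vertex of a
   child is the new midpoint, the second bisection cuts the only edge that the
   child still shares with [K']. *)
Definition descends K' K n :=
  [\/ K = K',
      exists p a b, [/\ K' = [fset p; a; b]%fset,
        K = [fset p; a; midpoint a b]%fset & n = midpoint a b] |
      hull K `<=` hull K' /\ (#|` K `&` K'| <= 1)%fset%N].

Lemma hull_half p a b : det3 p a b != 0 ->
  hull [fset p; a; midpoint a b]%fset `<=` hull [fset p; a; b]%fset.
Proof.
move=> h; have h2 : det3 p a (midpoint a b) != 0.
  rewrite midpointE det3_comb ?half_sum // [det3 p a a](_ : _ = 0); last by rewrite det3E; ring.
  by rewrite mulr0 add0r mulf_neq0 // invr_neq0.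
have [pK aK bK] : [/\ hull [fset p; a; b]%fset p, hull [fset p; a; b]%fset a &
    hull [fset p; a; b]%fset b].
  by split; apply: hull_vertex; rewrite !inE eqxx ?orbT.
by apply: hull_min => //; exact: midpoint_hull.
Qed.

Lemma descends_hull K' K n : is_triangle K' -> descends K' K n -> hull K `<=` hull K'.
Proof.
move=> tK' [-> //|[p [a [b [E -> _]]]]|[]//].
by rewrite E; apply: hull_half; apply: triangle_det3; rewrite -E.
Qed.

(** The new midpoint is never a vertex of [K']. After a first bisection the newest vertex [p] is
    itself a midpoint outside [K'], so only [a] can remain common; from then on the number of common
    vertices cannot grow. *)
Lemma descends_child K' p a b : is_triangle K' -> is_triangle [fset p; a; b]%fset ->
  descends K' [fset p; a; b]%fset p ->
  descends K' [fset p; a; midpoint a b]%fset (midpoint a b).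
Proof.
move=> tK' tK ds; have h := triangle_det3 tK; have [pa ab pb] := det3_neq0 h.
have sub := descends_hull tK' ds.
have [aK bK] : hull K' a /\ hull K' b.
  by split; apply: sub; apply: hull_vertex; rewrite !inE eqxx ?orbT.
have mK' := midpoint_not_vertex tK' aK bK ab.
case: ds => [KE|[p0 [a0 [b0 [KE' KE pE]]]]|[_ le1]].
- by constructor 2; exists p, a, b.
- constructor 3; split; first exact: subset_trans (hull_half h) sub.
  have pK' : p \notin K'.
    have h' := triangle_det3 (eq_ind _ (@is_triangle R) tK' _ KE').
    have [_ ab0 _] := det3_neq0 h'.
    rewrite pE; apply: midpoint_not_vertex => //;
    by apply: hull_vertex; rewrite KE' !inE eqxx ?orbT.
  rewrite -(cardfs1 a); apply: fsubset_leq_card; apply/fsubsetP => z.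
  rewrite !inE -orbA => /andP[/or3P[] /eqP -> //] /negPn zK; first by rewrite pK' in zK.
  by rewrite mK' in zK.
- constructor 3; split; first exact: subset_trans (hull_half h) sub.
  apply: leq_trans le1; apply: fsubset_leq_card; apply/fsubsetP => z.
  rewrite !inE -!orbA => /andP[/or3P[] /eqP -> zK]; rewrite ?eqxx ?zK ?orbT //.
  by rewrite (negbTE mK') in zK.
Qed.

Lemma midpointC a b : midpoint a b = midpoint b a.
Proof. by rewrite /midpoint addrC. Qed.

(** The newest vertex is part of the invariant: bisecting a child from another vertex could leave a
    whole edge of [K'] intact. *)
Lemma nvb_reach_descends T nv T' nv' : (forall K, K \in T -> is_triangle K) ->
  nvb_reach T nv T' nv' ->
  forall K, K \in T' -> exists2 K', K' \in T & descends K' K (nv' K).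
Proof.
move=> tri; elim=> [K KT|T1 nv1 K a b _ IH KT1 tK KE m ch K2]; first by exists K; [|constructor 1].
have [K' K'T ds] := IH _ KT1.
have step : K2 \in ch -> exists2 K', K' \in T & descends K' K2 m.
  have ds' : descends K' [fset nv1 K; a; b]%fset (nv1 K) by rewrite -KE.
  have tK' := tri _ K'T; have tK2 := tK; rewrite KE in tK2.
  rewrite !inE => /orP[] /eqP ->; exists K' => //; first exact: descends_child.
  rewrite /m midpointC; apply: descends_child => //.
    by rewrite fsetUAC.
  by rewrite fsetUAC.
rewrite in_fsetU; case: (boolP (K2 \in ch)) => [K2ch _|_]; first exact: step.
by rewrite orbF in_fsetD1 => /andP[_ /IH].
Qed.

Lemma shared_edge_half K K' E n : descends K' K n -> E \in edges K -> E \in edges K' ->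
  K = K' \/ half_of K K'.
Proof.
move=> ds EK EK'; case: ds => [->|[p [a [b [e1 e2 _]]]]|[_ le1]]; first by left.
  by right; exists p, a, b.
suff : (#|` E| <= 1)%N by rewrite (card_edge EK).
apply: leq_trans le1; apply: fsubset_leq_card.
by rewrite fsubsetI !edge_sub_triangle.
Qed.

End Bisection.
(** * The two sides of an edge *)

Section Adjacent.
Context {R : realType}.
Implicit Types (a b c p x y z : pt R) (K E : cell R).
Variables (Omega : set (pt R)) (o : cell R -> pt R * pt R).

Local Notation sideo E K := (side (o E).1 (o E).2 K).

Lemma normalE E : normal o E = (elen o E)^-1 *: rot90 ((o E).2 - (o E).1).
Proof. by rewrite /normal /tangent /rot90 !pairZ /= mulrN. Qed.

Lemma enorm_gt0 x : x != 0 -> 0 < enorm x.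
Proof.
move=> x0; rewrite /enorm sqrtr_gt0 lt_neqAle /dot -!expr2 addr_ge0 ?sqr_ge0 //.
rewrite andbT eq_sym paddr_eq0 ?sqr_ge0 // !sqrf_eq0.
by apply: contra x0 => /andP[/eqP h1 /eqP h2]; rewrite [x]surjective_pairing h1 h2.
Qed.

(** The ray starts at the midpoint of the edge and [normal] points to its positive side, so the
    limit condition becomes the sign of a determinant. *)
Lemma points_into_side K E : is_triangle K -> E \in edges K ->
  E = [fset (o E).1; (o E).2]%fset -> points_into o E K <-> sideo E K.
Proof.
move=> tK EK EE; set z0 := (o E).1 in EE *; set z1 := (o E).2 in EE *.
have := EK; rewrite {1}EE => /(edgeP _ _ tK)[z01 [c [KE h]]].
have dd := dot_rot90_sqr z01.
have len0 : 0 < elen o E by apply: enorm_gt0; rewrite subr_eq0 eq_sym.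
have dE : dot (rot90 (z1 - z0)) (normal o E) =
   (elen o E)^-1 * dot (rot90 (z1 - z0)) (rot90 (z1 - z0)).
  by rewrite normalE /dot !pairZ /=; ring.
have pos : 0 < dot (rot90 (z1 - z0)) (normal o E).
  by rewrite dE mulr_gt0 // invr_gt0.
rewrite KE sideE; split => [pin|hc].
  have /filter_ex[e [e0 hull_e]] : \forall e \near 0^'+, 0 < e /\
      hull K (seg z0 z1 2^-1 + e *: normal o E).
    near=> e; split => //; near: e; rewrite KE; exact: pin.
  move: hull_e; rewrite KE => /(hull_det3_sign h).
  by rewrite det3_ray det3_seg add0r pmulr_rge0 ?mulr_gt0 // le_eqVlt eq_sym (negbTE h).
rewrite /points_into; apply: near_in_hull => //; last exact: mulr_gt0.
by apply/andP; split; lra.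
Unshelve. all: by end_near. Qed.

Section OneMesh.
Variable T : {fset cell R}.
Hypothesis domO : polygonal_lipschitz_domain Omega.
Hypothesis triT : triangulation Omega T.
Hypothesis orT : orientation Omega T o.

Let tri K : K \in T -> is_triangle K. Proof. by case: triT => h _ _; exact: h. Qed.
Let conf : conforming T. Proof. by case: triT. Qed.

Lemma oriented_edge K E : K \in T -> E \in edges K -> E = [fset (o E).1; (o E).2]%fset.
Proof. by move=> KT EK; have [] := orT (ex_intro2 _ _ K KT EK). Qed.

Lemma same_sideo E K K' : K \in T -> K' \in T -> E \in edges K -> E \in edges K' ->
  sideo E K = sideo E K' -> K = K'.
Proof.
move=> KT K'T EK EK'; have EE := oriented_edge KT EK.
by apply: (same_side tri conf) => //; rewrite -EE.
Qed.

(** [KR] and [KL] are selected by [xget]; uniqueness of the triangle on each side identifies the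
    selected one. *)
Lemma KR_eq E K : K \in T -> E \in edges K -> sideo E K -> KR T o E = K.
Proof.
move=> KT EK sd; have EE := oriented_edge KT EK.
apply: xget_unique => [|K' [[K'T EK'] /points_into_side sd']].
  by split => //; apply/points_into_side => //; exact: tri.
by apply: (same_sideo K'T KT EK' EK); rewrite sd sd' //; exact: tri.
Qed.

Lemma KL_eq E K K' : ~ boundary_edge Omega E -> K \in T -> E \in edges K ->
  ~~ sideo E K -> K' \in T -> E \in edges K' -> sideo E K' -> KL Omega T o E = K.
Proof.
move=> nb KT EK sd K'T EK' sd'; rewrite /KL; case: asboolP => // _.
rewrite (KR_eq K'T EK' sd'); apply: xget_unique => [|K2 [[K2T EK2] ne]].
  by split => // e; move: sd; rewrite e sd'.
apply: (same_sideo K2T KT EK2 EK); rewrite (negbTE sd); apply/negbTE/negP => sd2.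
by apply: ne; apply: (same_sideo K2T K'T EK2 EK'); rewrite sd' sd2.
Qed.

Lemma KL_boundary E K : boundary_edge Omega E -> K \in T -> E \in edges K ->
  KL Omega T o E = K.
Proof.
move=> bE KT EK; rewrite /KL; case: asboolP => // _.
have EE := oriented_edge KT EK.
apply: xget_unique => // K' [K'T EK'].
by apply: (boundary_edge_unique domO triT (z0 := (o E).1) (z1 := (o E).2)); rewrite -?EE.
Qed.

Lemma interior_edge_sides E K : ~ boundary_edge Omega E -> K \in T -> E \in edges K ->
  exists K1 K2, [/\ K1 \in T, E \in edges K1 & ~~ sideo E K1] /\
    [/\ K2 \in T, E \in edges K2 & sideo E K2].
Proof.
move=> nb KT EK; have EE := oriented_edge KT EK.
have EK1 := EK; rewrite EE in EK1; have nb1 := nb; rewrite EE in nb1.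
have [K' [K'T EK' sd]] := interior_edge_neighbour domO triT KT EK1 nb1.
rewrite -EE in EK'.
case: (boolP (sideo E K)) => sK; last by exists K, K'; do !split; rewrite // sd.
by exists K', K; do !split; rewrite // sd sK.
Qed.

(** A triangle with the edge [E] is determined by a boolean, its side. *)
Lemma card_adjacent E : (#|` [fset K in T | E \in edges K]| <= 2)%fset%N.
Proof.
pose A := [fset K in T | E \in edges K]%fset.
have inj : {in A &, injective (fun K => sideo E K)}.
  move=> K K'; rewrite in_fset /= => /andP[KT EK]; rewrite in_fset /= => /andP[K'T EK'].
  exact: (same_sideo KT K'T EK EK').
rewrite -(card_in_imfset imfset_key inj).
apply: (@leq_trans #|` [fset true; false]|%fset); last by rewrite cardfs2.
by apply: fsubset_leq_card; apply/fsubsetP => -[]; rewrite !inE.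
Qed.

End OneMesh.

Section TwoMeshes.
Variables (T That : {fset cell R}) (par : cell R -> cell R).
Hypothesis domO : polygonal_lipschitz_domain Omega.
Hypothesis triT : triangulation Omega T.
Hypothesis triTh : triangulation Omega That.
Hypothesis orT : orientation Omega T o.
Hypothesis orTh : orientation Omega That o.
Hypothesis parT : forall K, K \in That -> par K \in T.
Hypothesis par_hull : forall K, K \in That -> hull K `<=` hull (par K).

Let tri K : K \in T -> is_triangle K. Proof. by case: triT => h _ _; exact: h. Qed.
Let trih K : K \in That -> is_triangle K. Proof. by case: triTh => h _ _; exact: h. Qed.
Let conf : conforming T. Proof. by case: triT. Qed.

(** [E] lies in [Kh], hence in [par Kh], and in the conforming mesh [T] a mesh edge contained in a
    triangle is one of its edges. *)
Lemma par_edge K Kh E : K \in T -> E \in edges K -> Kh \in That -> E \in edges Kh ->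
  E \in edges (par Kh).
Proof.
move=> KT EK KhT EKh.
apply: (edge_of_subhull tri conf KT (parT KhT) EK).
by apply: subset_trans (par_hull KhT); apply: hull_sub; exact: edge_sub_triangle.
Qed.

(** The third vertex of [Kh] lies in [par Kh], hence on the same closed side of [E] as the third
    vertex of [par Kh]. *)
Lemma par_side Kh E : Kh \in That -> E \in edges Kh -> E \in edges (par Kh) ->
  sideo E (par Kh) = sideo E Kh.
Proof.
move=> KhT EKh EpK; have EE := oriented_edge orTh KhT EKh.
set z0 := (o E).1 in EE *; set z1 := (o E).2 in EE *.
have := EKh; rewrite {1}EE => /(edgeP _ _ (trih KhT))[z01 [c [KE h]]].
have := EpK; rewrite {1}EE => /(edgeP _ _ (tri (parT KhT)))[_ [c' [KE' h']]].
have : hull (par Kh) c.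
  by apply: par_hull => //; apply: hull_vertex; rewrite KE !inE eqxx orbT.
rewrite KE' KE !sideE => /(hull_det3_sign h') hle.
move: h h' hle; rewrite !neq_lt => /orP[p|p] /orP[q|q].
- by rewrite !ltNge (ltW p) (ltW q).
- by rewrite leNgt nmulr_rlt0 // q.
- by rewrite leNgt pmulr_rlt0 // q.
- by rewrite p q.
Qed.

(** The hypotheses only place [K] inside [par K]; sharing an edge and its side with [K] identifies
    the latter. *)
Lemma par_id K : K \in T -> K \in That -> par K = K.
Proof.
move=> KT KTh; have [a [b [c [KE h]]]] := tri KT.
have [ab _ _] := det3_neq0 h.
have EK : [fset a; b]%fset \in edges K.
  by apply/(edgeP _ _ (tri KT)); split => //; exists c.
have EpK := par_edge KT EK KTh EK.
by apply: (same_sideo triT orT (parT KTh) KT EpK EK); exact: par_side.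
Qed.

Lemma par_KL_boundary K E : boundary_edge Omega E ->
  K \in T -> K \in That -> E \in edges K ->
  KL Omega T o E = K /\ KL Omega That o E = K.
Proof.
move=> bE KT KTh EK; split; first exact: (KL_boundary domO triT orT).
exact: (KL_boundary domO triTh orTh).
Qed.

(** Both meshes orient [E] by the same [o] and [par] preserves sides, so left goes to left and right
    to right. *)
Lemma par_KLR K E : ~ boundary_edge Omega E -> K \in T -> K \in That -> E \in edges K ->
  exists K1 K2, [/\ [/\ K1 \in That, E \in edges K1, K2 \in That & E \in edges K2],
    K1 != K2, KL Omega That o E = K1, KR That o E = K2 &
    KL Omega T o E = par K1 /\ KR T o E = par K2].
Proof.
move=> nb KT KTh EK.
have [K1 [K2 [[K1T E1 s1] [K2T E2 s2]]]] := interior_edge_sides domO triTh orTh nb KTh EK.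
have p1 := par_edge KT EK K1T E1; have p2 := par_edge KT EK K2T E2.
have s1' : ~~ sideo E (par K1) by rewrite par_side.
have s2' : sideo E (par K2) by rewrite par_side.
exists K1, K2; split => //.
- by apply/eqP => e; move: s1; rewrite e s2.
- exact: (KL_eq triTh orTh nb K1T E1 s1 K2T E2 s2).
- exact: (KR_eq triTh orTh).
- split; last exact: (KR_eq triT orT (parT K2T)).
  exact: (KL_eq triT orT nb (parT K1T) p1 s1' (parT K2T) p2 s2').
Qed.

End TwoMeshes.
End Adjacent.
(** * Shape regularity *)

Section ShapeRegularity.
Context {R : realType}.
Implicit Types (a b c p x y z : pt R) (K E : cell R) (s t d l : R).
Implicit Types (T : {fset cell R}).

Lemma enorm_ge_coord x : `|x.1| <= enorm x /\ `|x.2| <= enorm x.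
Proof.
rewrite /enorm /dot -!expr2; split; rewrite -sqrtr_sqr ler_wsqrtr //.
  by rewrite lerDl sqr_ge0.
by rewrite lerDr sqr_ge0.
Qed.

Lemma enorm_le_coord x : enorm x <= `|x.1| + `|x.2|.
Proof.
rewrite /enorm /dot -!expr2 -[leRHS](@ger0_norm _ _) ?addr_ge0 // -sqrtr_sqr.
rewrite ler_wsqrtr // sqrrD !real_normK ?num_real // -addrA lerD2l lerDr.
by rewrite mulrn_wge0 // mulr_ge0.
Qed.

Lemma enormZ s x : enorm (s *: x) = `|s| * enorm x.
Proof.
rewrite /enorm -sqrtr_sqr -sqrtrM ?sqr_ge0 //; congr Num.sqrt.
by rewrite /dot !pairZ /=; ring.
Qed.

Lemma enorm_ge0 x : 0 <= enorm x. Proof. exact: sqrtr_ge0. Qed.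

Definition inball K c d := forall x, enorm (x - c) <= d / 2 -> hull K x.

(** Along the diameter of the ball parallel to an edge of length [L], the coordinate at [z1] grows
    by [d / L], and it stays between 0 and 1. *)
Lemma inball_le_edge K z0 z1 c d : is_triangle K -> [fset z0; z1]%fset \in edges K ->
  0 <= d -> inball K c d -> d <= enorm (z1 - z0).
Proof.
move=> tK /(edgeP _ _ tK)[z01 [c' [KE h]]] d0 ball.
have L0 : 0 < enorm (z1 - z0) by apply: enorm_gt0; rewrite subr_eq0 eq_sym.
set L := enorm (z1 - z0) in L0 *.
have h1 : det3 z1 c' z0 != 0 by rewrite (det3_rot z0 z1 c').
have dL : 0 <= d / L / 2 by rewrite !divr_ge0 // ltW.
have inb s : `|s| = d / L / 2 -> hull K (c + s *: (z1 - z0)).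
  move=> sE; apply: ball; rewrite addrC addKr enormZ sE -/L.
  by rewrite (_ : d / L / 2 * L = d / 2) //; field; exact: lt0r_neq0.
have hx : hull K (c + (d / L / 2) *: (z1 - z0)) by apply: inb; rewrite ger0_norm.
have hy : hull K (c + - (d / L / 2) *: (z1 - z0)) by apply: inb; rewrite normrN ger0_norm.
have coef : dot (rot90 (z0 - c')) (z1 - z0) / det3 z1 c' z0 = 1.
  apply/eqP; rewrite -(inj_eq (mulIf h1)) divfK // mul1r; apply/eqP.
  by rewrite det3E /dot /=; ring.
move: hx hy; rewrite KE => /(hull3P _ h)[x0 x1 x2] /(hull3P _ h)[y0 y1 y2].
have sx := bary_sum (c + (d / L / 2) *: (z1 - z0)) h.
have x1' : bary z1 c' z0 (c + (d / L / 2) *: (z1 - z0)) <= 1 by lra.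
move: x1' y1; rewrite !(bary_ray _ _ _ c) coef => x1' y1.
by rewrite -[leRHS]mul1r -ler_pdivrMr //; lra.
Qed.

Lemma exists_inball K : is_triangle K -> exists c d, 0 < d /\ inball K c d.
Proof.
case=> a [b [c [KE h]]]; pose g := 3^-1 *: a + 3^-1 *: b + 3^-1 *: c.
have [g1 g2 g3] : [/\ bary a b c g = 3^-1, bary b c a g = 3^-1 & bary c a b g = 3^-1].
  by apply: bary_unique => //; lra.
have : nbhs g (hull K).
  near=> y; rewrite KE; apply/(hull3P _ h); split; apply: ltW; near: y; apply: bary_near_pos.
  - by rewrite g1; lra.
  - by rewrite g2; lra.
  - by rewrite g3; lra.
move=> /nbhs_ballP[e /= e0 eK]; exists g, e; split => // x xg.
have [n1 n2] := enorm_ge_coord (x - g); apply: eK; split => /=.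
  by rewrite /ball /= distrC; apply: le_lt_trans n1 _; lra.
by rewrite /ball /= distrC; apply: le_lt_trans n2 _; lra.
Unshelve. all: by end_near. Qed.

Lemma hull_bounded K : is_triangle K -> exists M, forall x, hull K x -> `|x.1| <= M /\ `|x.2| <= M.
Proof.
case=> a [b [c [KE h]]].
exists (`|a.1| + `|a.2| + (`|b.1| + `|b.2|) + (`|c.1| + `|c.2|)) => x.
rewrite KE => /(hull3P _ h)[p0 q0 r0]; have s1 := bary_sum x h.
rewrite (bary_comb x h).
move: (bary a b c x) (bary b c a x) (bary c a b x) p0 q0 r0 s1 => p q r p0 q0 r0 s1.
have sc s t : 0 <= s -> s <= 1 -> `|s * t| <= `|t|.
  by move=> s0 s1'; rewrite normrM ger0_norm // ler_piMl.
have [p1 [q1 r1]] : p <= 1 /\ q <= 1 /\ r <= 1 by lra.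
rewrite !pairZ !pairD /=.
have b1 := ler_normD (p * a.1 + q * b.1) (r * c.1).
have b2 := ler_normD (p * a.2 + q * b.2) (r * c.2).
have b3 := ler_normD (p * a.1) (q * b.1).
have b4 := ler_normD (p * a.2) (q * b.2).
have c1 := sc _ a.1 p0 p1; have c2 := sc _ a.2 p0 p1.
have c3 := sc _ b.1 q0 q1; have c4 := sc _ b.2 q0 q1.
have c5 := sc _ c.1 r0 r1; have c6 := sc _ c.2 r0 r1.
have := normr_ge0 a.1; have := normr_ge0 b.1; have := normr_ge0 c.1.
have := normr_ge0 a.2; have := normr_ge0 b.2; have := normr_ge0 c.2.
by split; lra.
Qed.

Lemma enorm_le_diam K x y : is_triangle K -> hull K x -> hull K y ->
  enorm (x - y) <= diam (hull K).
Proof.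
move=> tK hx hy; apply: ub_le_sup; last by exists x, y.
have [M hM] := hull_bounded tK.
exists (4 * M) => _ [x' [y' [/hM[x1 x2] /hM[y1 y2] ->]]].
apply: le_trans (enorm_le_coord _) _ => /=.
have := ler_normB x'.1 y'.1; have := ler_normB x'.2 y'.2; lra.
Qed.

Lemma gamma_inball T K : is_triangle K -> K \in T ->
  exists c d, [/\ 0 < d, inball K c d &
    forall x y, hull K x -> hull K y -> enorm (x - y) <= 2 * gamma T * d].
Proof.
move=> tK KT.
pose S := [set d | 0 <= d /\ exists c, forall x, enorm (x - c) <= d / 2 -> hull K x].
have [a [b [c [KE h]]]] := tK; have [ab _ _] := det3_neq0 h.
have EK : [fset a; b]%fset \in edges K by apply/(edgeP _ _ tK); split => //; exists c.
(* Boundedness makes [rho] a genuine supremum rather than a default value. *)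
have ubS : has_ubound S.
  by exists (enorm (b - a)) => d [d0 [c' ball]]; exact: (inball_le_edge tK EK d0 ball).
have [c0 [d0 [d0_gt0 ball0]]] := exists_inball tK.
have S0 : S d0 by split; [exact: ltW|exists c0].
have rho0 : 0 < rho (hull K) by apply: lt_le_trans d0_gt0 _; exact: ub_le_sup.
have r2 : 0 < rho (hull K) / 2 by lra.
(* The supremum is not shown to be attained; a ball of more than half the optimal diameter is
   enough. *)
have [|d [d_ge0 [c' ball]] dlt] := @sup_adherent _ S _ r2; first by split => //; exists d0.
have dgt : rho (hull K) / 2 < d by move: dlt; rewrite -/(rho (hull K)); lra.
exists c', d; split => // [|x y hx hy]; first lra.
apply: le_trans (enorm_le_diam tK hx hy) _.
have g : diam (hull K) / rho (hull K) <= gamma T.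
  rewrite /gamma.
  by apply: (@le_bigmax_seq _ R _ _ 0 K xpredT (fun K => diam (hull K) / rho (hull K))).
have : diam (hull K) <= gamma T * rho (hull K) by rewrite -ler_pdivrMr.
have g0 : 0 <= gamma T.
  apply: le_trans g; rewrite divr_ge0 ?(ltW rho0) //.
  exact: le_trans (enorm_ge0 _) (enorm_le_diam tK hx hy).
nra.
Qed.

(** The homothety of centre [a] and ratio 1/2 maps [K'] into the child with vertex [a], and the ball
    to one of half the diameter. *)
Lemma half_inball K K' c d : is_triangle K' -> half_of K K' -> inball K' c d ->
  exists c', inball K c' (d / 2).
Proof.
move=> tK' [p [a [b [KE' KE]]]] ball.
have h : det3 p a b != 0 by apply: triangle_det3; rewrite -KE'.
exists (2^-1 *: (a + c)) => x xc.
have : hull K' (2 *: x - a).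
  apply: ball; rewrite (_ : 2 *: x - a - c = 2 *: (x - 2^-1 *: (a + c))).
    by rewrite enormZ ger0_norm //; lra.
  by rewrite !pairZ !pairN !pairD /=; congr (_, _); field.
rewrite KE' => /(hull3P _ h)[p0 q0 r0]; have s1 := bary_sum (2 *: x - a) h.
have yE := bary_comb (2 *: x - a) h.
move: (bary p a b _) (bary a b p _) (bary b p a _) p0 q0 r0 s1 yE => u v w p0 q0 r0 s1 yE.
have h2 : det3 p a (midpoint a b) != 0.
  rewrite midpointE det3_comb ?half_sum // [det3 p a a](_ : _ = 0); last by rewrite det3E; ring.
  by rewrite mulr0 add0r mulf_neq0 // invr_neq0.
(* Obtained from the coordinates of [2 *: x - a] by substituting [b = 2 *: midpoint a b - a]. *)
have xE : x = (u / 2) *: p + ((1 + v - w) / 2) *: a + w *: midpoint a b.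
  have -> : x = 2^-1 *: ((2 *: x - a) + a) by rewrite subrK scalerA mulVf ?scale1r.
  by rewrite yE /midpoint !pairZ !pairD /=; congr (_, _); field.
have sm : u / 2 + (1 + v - w) / 2 + w = 1 by lra.
have [e1 e2 e3] := bary_unique h2 sm.
by rewrite KE; apply/(hull3P _ h2); rewrite xE e1 e2 e3; split; lra.
Qed.

Definition box c l : set (pt R) := [set x | `|x.1 - c.1| < l /\ `|x.2 - c.2| < l].

Lemma box_interior c l (A : set (pt R)) : 0 < l -> box c (2 * l) `<=` A -> box c l `<=` interior A.
Proof.
move=> l0 bA x [x1 x2]; apply: (filterS (P := ball x l)); last exact: nbhsx_ballx.
move=> y [/= y1 y2]; apply: bA; rewrite /ball /= in y1 y2.
have e1 := ler_distD x.1 y.1 c.1; have e2 := ler_distD x.2 y.2 c.2.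
by move: e1 e2; rewrite (distrC y.1 x.1) (distrC y.2 x.2); split; lra.
Qed.

(* 32 = 2 * 2 * 8: the inscribed ball is optimal up to a factor 2, halving the
   triangle costs another 2, and a ball of diameter [d] contains a box of
   half-side [2 * (d / 8)]. *)
Lemma shape_regular_box T K K' : is_triangle K -> is_triangle K' -> K' \in T ->
  K = K' \/ half_of K K' -> hull K `<=` hull K' ->
  exists c l, [/\ 0 < l, box c l `<=` interior (hull K),
    forall x y, hull K x -> hull K y -> enorm (x - y) <= 32 * gamma T * l,
    forall x, hull K x -> `|x.1 - c.1| <= 32 * gamma T * l /\ `|x.2 - c.2| <= 32 * gamma T * l &
    forall z0 z1, [fset z0; z1]%fset \in edges K -> l <= enorm (z1 - z0)].
Proof.
move=> tK tK' K'T KK' sub.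
have [c' [d' [d'0 ball' diam']]] := gamma_inball tK' K'T.
have [c ball] : exists c, inball K c (d' / 2).
  case: KK' => [->|hf]; last exact: half_inball hf ball'.
  by exists c' => x xc; apply: ball'; lra.
have cK : hull K c by apply: ball; rewrite subrr -(scale0r 0) enormZ normr0 mul0r; lra.
have dm x y : hull K x -> hull K y -> enorm (x - y) <= 32 * gamma T * (d' / 16).
  by move=> /sub hx /sub hy; have := diam' _ _ hx hy; lra.
exists c, (d' / 16); split => //; first lra.
- apply: box_interior; first lra.
  move=> x [x1 x2]; apply: ball; apply: le_trans (enorm_le_coord _) _ => /=; lra.
- move=> x hx; have [n1 n2] := enorm_ge_coord (x - c); have := dm _ _ hx cK.
  by move=> h; split; [apply: le_trans n1 h|apply: le_trans n2 h].
- move=> z0 z1 EK; have := inball_le_edge tK EK _ ball; lra.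
Qed.

End ShapeRegularity.
(** * Inverse inequalities for polynomials *)

Section InverseInequality.
Context {R : realType}.
Implicit Types (k : nat) (c x y : pt R) (p q : {poly R}) (P : {poly {poly R}}).
Implicit Types (r l s M B : R).

(** Values and increments are bounded together, since the increment of [p * 'X + a] involves the
    values of [p]. *)
Lemma poly_bound_lipschitz p r : 0 <= r -> exists B, 0 <= B /\
  forall s, `|s| <= r -> `|p.[s]| <= B /\
    forall s', `|s'| <= r -> `|p.[s] - p.[s']| <= B * `|s - s'|.
Proof.
move=> r0; elim/poly_ind: p => [|p a [B [B0 hB]]].
  exists 0; split => // s _; rewrite horner0 normr0; split => // s' _.
  by rewrite horner0 subrr normr0 mul0r.
exists (B * r + `|a| + B); split; first by rewrite !addr_ge0 // mulr_ge0.
move=> s sr; have [bs ls] := hB s sr; rewrite !hornerE; split.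
  apply: le_trans (ler_normD _ _) _; rewrite normrM.
  have : `|p.[s]| * `|s| <= B * r by rewrite ler_pM.
  lra.
move=> s' s'r; have [bs' _] := hB s' s'r; rewrite !hornerE.
have -> : p.[s] * s + a - (p.[s'] * s' + a) = (p.[s] - p.[s']) * s + p.[s'] * (s - s') by ring.
apply: le_trans (ler_normD _ _) _; rewrite !normrM.
have h1 : `|p.[s] - p.[s']| * `|s| <= (B * `|s - s'|) * r.
  by rewrite ler_pM // ls.
have h2 : `|p.[s']| * `|s - s'| <= B * `|s - s'| by rewrite ler_wpM2r.
have h3 : 0 <= `|a| * `|s - s'| by rewrite mulr_ge0.
lra.
Qed.

Lemma polys_bound_lipschitz (I : finType) (F : I -> {poly R}) r : 0 <= r ->
  exists B, 0 <= B /\ forall i s, `|s| <= r -> `|(F i).[s]| <= B /\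
    forall s', `|s'| <= r -> `|(F i).[s] - (F i).[s']| <= B * `|s - s'|.
Proof.
move=> r0; have /choice[B hB] := fun i => poly_bound_lipschitz (F i) r0.
have B0 i : 0 <= B i by have [] := hB i.
exists (\sum_i B i); split; first by apply: sumr_ge0.
have le i : B i <= \sum_i B i by rewrite (bigD1 i) //= lerDl sumr_ge0.
move=> i s sr; have [_ /(_ s sr)[b1 b2]] := hB i; split; first exact: le_trans (le i).
by move=> s' s'r; apply: le_trans (b2 _ s'r) _; rewrite ler_wpM2r.
Qed.

(** The nodes stop at [k / (k + 1)], which leaves room on the right for a box around the last
    one. *)
Definition node k (j : nat) : R := j%:R / k.+1%:R.

Lemma node_inj k : injective (node k).
Proof.
move=> i j; have u : (k.+1%:R)^-1 != 0 :> R by rewrite invr_neq0.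
by move/(mulIf u)/eqP; rewrite eqr_nat => /eqP.
Qed.

(** After rescaling by [l], [p] is a combination of fixed Lagrange polynomials with coefficients at
    most [M]; their bounds on [[-r, r]] depend only on [k] and [r]. *)
Lemma univariate_inverse k r : 0 <= r -> exists B, 0 < B /\
  forall p a l M, 0 < l -> (size p <= k.+1)%N ->
  (forall j : 'I_k.+1, `|p.[a + l * node k j]| <= M) ->
  forall s, `|s - a| <= r * l ->
  [/\ `|p.[s]| <= B * M, `|p^`().[s]| <= B * M / l &
   forall s', `|s' - a| <= r * l -> `|p.[s] - p.[s']| <= B * M * `|s - s'| / l].
Proof.
move=> r0.
pose L (j : 'I_k.+1) : {poly R} := (tnth (k.+1.-lagrange (node k)) j).
have [B1 [B10 h1]] := polys_bound_lipschitz L r0.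
have [B2 [B20 h2]] := polys_bound_lipschitz (fun j => (L j)^`()) r0.
exists (k.+1%:R * (B1 + B2) + 1); split.
  by rewrite ltr_wpDl // mulr_ge0 // addr_ge0.
move=> p a l M l0 sp nodeM.
have M0 : 0 <= M by exact: le_trans (nodeM ord0).
pose q := p \Po (l *: 'X + a%:P).
have sq : (size q <= k.+1)%N.
  rewrite size_comp_poly2 // size_addl ?size_scale ?size_polyX ?(gt_eqF l0) //.
  by rewrite size_polyC; case: (_ != _).
have qE u : q.[u] = p.[a + l * u].
  by rewrite horner_comp !hornerE addrC.
have qL : q = \sum_(j < k.+1) q.[node k j] *: L j.
  rewrite {1}(lagrange_gen (ltn0Sn k) (@node_inj k) sq).
  by apply: eq_bigr => j _; rewrite mul_polyC.
have qM (j : 'I_k.+1) : `|q.[node k j]| <= M by rewrite qE.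
have lin (F : 'I_k.+1 -> R) b C : (forall j, `|F j| <= b) -> b <= C ->
   `|\sum_(j < k.+1) q.[node k j] * F j| <= k.+1%:R * C * M.
  move=> Fb bC; apply: le_trans (ler_norm_sum _ _ _) _.
  apply: (@le_trans _ _ (\sum_(j < k.+1) C * M)); last first.
    by rewrite sumr_const card_ord -mulrA mulr_natl.
  apply: ler_sum => j _; rewrite normrM mulrC ler_pM //.
  exact: le_trans (Fb j) bC.
move=> s sr.
pose u t := (t - a) / l.
have uE t : a + l * u t = t by rewrite /u mulrC divfK ?gt_eqF // addrC subrK.
have ur t : `|t - a| <= r * l -> `|u t| <= r.
  by move=> tr; rewrite normrM normfV (gtr0_norm l0) ler_pdivrMr.
have pu t : p.[t] = \sum_(j < k.+1) q.[node k j] * (L j).[u t].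
  rewrite -{1}(uE t) -qE {1}qL horner_sum.
  by apply: eq_bigr => j _; rewrite hornerZ.
have BB : 0 <= k.+1%:R * B1 * M by rewrite !mulr_ge0.
have BB2 : 0 <= k.+1%:R * B2 * M by rewrite !mulr_ge0.
split.
- rewrite pu; apply: le_trans (lin _ B1 B1 _ _) _ => // [j|].
    by have [] := h1 j (u s) (ur _ sr).
  nra.
- have dq : q^`().[u s] = l * p^`().[s].
    rewrite deriv_comp hornerM horner_comp derivD derivZ derivX derivC addr0.
    rewrite hornerZ hornerC mulr1 [RHS]mulrC; congr (_.[_] * _).
    by rewrite hornerD hornerZ hornerX hornerC addrC uE.
  have -> : p^`().[s] = q^`().[u s] / l by rewrite dq mulrC mulKf // gt_eqF.
  rewrite normrM normfV (gtr0_norm l0) ler_pM2r ?invr_gt0 //.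
  rewrite {1}qL (linear_sum (@deriv R)) horner_sum.
  under eq_bigr do rewrite /= derivZ hornerZ.
  apply: le_trans (lin _ B2 B2 _ _) _ => // [j|].
    by have [] := h2 j (u s) (ur _ sr).
  nra.
- move=> s' s'r; rewrite !pu -sumrB.
  under eq_bigr do rewrite -mulrBr.
  apply: le_trans (lin _ (B1 * `|u s - u s'|) (B1 * `|u s - u s'|) _ _) _ => // [j|].
    by have [_ h] := h1 j (u s) (ur _ sr); apply: h; exact: ur.
  have -> : u s - u s' = (s - s') / l by rewrite /u; ring.
  rewrite normrM normfV (gtr0_norm l0).
  rewrite -[leRHS]mulrA.
  have n0 : 0 <= `|s - s'| / l by rewrite divr_ge0 // ltW.
  nra.
Qed.

End InverseInequality.

(** * Inverse inequalities in two variables *)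

Section BivariateInverse.
Context {R : realType}.
Implicit Types (k : nat) (c x y : pt R) (p q : {poly R}) (P : {poly {poly R}}).
Implicit Types (r l s M B : R).

(** The index names the variable that stays free: [slice1 P s] is P(., s) and [slice2 P s] is P(s,
    .). *)
Definition slice1 P s : {poly R} := map_poly (horner_eval s) P.
Definition slice2 P s : {poly R} := P.[s%:P].

Lemma slice1E P x : (slice1 P x.2).[x.1] = peval P x.
Proof.
have /= := horner_map (horner_eval x.2) P x.1%:P.
by rewrite !horner_evalE hornerC.
Qed.

Lemma slice2E P x : (slice2 P x.1).[x.2] = peval P x.
Proof. by []. Qed.

Lemma slice1_d1 P x : (slice1 P x.2)^`().[x.1] = peval (d1 P) x.
Proof. by rewrite deriv_map -/(slice1 _ _) slice1E. Qed.

Lemma slice2_d2 P x : (slice2 P x.1)^`().[x.2] = peval (d2 P) x.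
Proof.
rewrite -slice2E /slice2 /d2; congr (_.[_]); elim/poly_ind: P => [|P p IH].
  by rewrite horner0 deriv0 map_poly0 horner0.
rewrite !hornerE derivD derivM derivC mulr0 addr0 IH.
have -> : map_poly (fun q => q^`()) (P * 'X + p%:P) =
    map_poly (fun q => q^`()) P * 'X + (p^`())%:P.
  apply/polyP => i; rewrite coef_map_id0 ?deriv0 // !coefD !coefMX !coefC.
  rewrite derivD; case: i => [|i] /=; first by rewrite deriv0.
  by rewrite coef_map_id0 ?deriv0.
by rewrite !hornerE.
Qed.

Lemma coef_d2 P i : (d2 P)`_i = (P`_i)^`().
Proof. by rewrite /d2 coef_map_id0 ?deriv0. Qed.

Lemma total_degree_d1 k P : total_degree_le k P -> total_degree_le k (d1 P).
Proof.
move=> h i j kij; rewrite /d1 coef_deriv coefMn h ?mul0rn //.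
by apply: ltn_trans kij _; rewrite addSn.
Qed.

Lemma total_degree_d2 k P : total_degree_le k P -> total_degree_le k (d2 P).
Proof.
move=> h i j kij; rewrite coef_d2 coef_deriv h ?mul0rn //.
by apply: ltn_trans kij _; rewrite addnS.
Qed.

Lemma total_degreeB k P Q : total_degree_le k P -> total_degree_le k Q ->
  total_degree_le k (P - Q).
Proof. by move=> hP hQ i j kij; rewrite !coefB hP // hQ // subrr. Qed.

Lemma pevalB P Q x : peval (P - Q) x = peval P x - peval Q x.
Proof. by rewrite /peval !hornerE. Qed.

Lemma d1B P Q : d1 (P - Q) = d1 P - d1 Q. Proof. exact: derivB. Qed.

Lemma d2B P Q : d2 (P - Q) = d2 P - d2 Q.
Proof. by apply/polyP => i; rewrite coefB !coef_d2 coefB derivB. Qed.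

Lemma gradB P Q x : grad (P - Q) x = grad P x - grad Q x.
Proof. by rewrite /grad d1B d2B !pevalB. Qed.

Lemma laplacianB P Q x : laplacian (P - Q) x = laplacian P x - laplacian Q x.
Proof.
by rewrite /laplacian !(d1B, d2B) addrACA -opprD pevalB.
Qed.

Lemma size_slice1 k P s : total_degree_le k P -> (size (slice1 P s) <= k.+1)%N.
Proof.
move=> h; apply/leq_sizeP => i ki; rewrite coef_map /= horner_evalE.
have -> : P`_i = 0 by apply/polyP => j; rewrite h ?coef0 // (leq_trans ki) // leq_addr.
by rewrite horner0.
Qed.

Lemma size_slice2 k P s : total_degree_le k P -> (size (slice2 P s) <= k.+1)%N.
Proof.
move=> h; apply/leq_sizeP => j kj; rewrite /slice2 horner_coef coef_sum.
apply: big1 => i _; rewrite -rmorphXn /= coefMC h ?mul0r //.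
by rewrite (leq_trans kj) // leq_addl.
Qed.

(** Interpolation in one variable carries the nodal bound to whole grid lines, interpolation in the
    other from there to the square; each passage costs a factor [B]. *)
Lemma bivariate_inverse k r : 1 <= r -> exists B, 0 < B /\
  forall P c l M, 0 < l -> total_degree_le k P ->
  (forall i j : 'I_k.+1, `|peval P (c.1 + l * node k i, c.2 + l * node k j)| <= M) ->
  forall x, `|x.1 - c.1| <= r * l -> `|x.2 - c.2| <= r * l ->
  [/\ `|peval P x| <= B * M, `|peval (d1 P) x| <= B * M / l,
    `|peval (d2 P) x| <= B * M / l &
   forall y, `|y.1 - c.1| <= r * l -> `|y.2 - c.2| <= r * l ->
     `|peval P x - peval P y| <= B * M * (`|x.1 - y.1| + `|x.2 - y.2|) / l].
Proof.
move=> r1; have r0 : 0 <= r by lra.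
have [B [B0 uni]] := @univariate_inverse R k r r0.
exists (B * B); split; first exact: mulr_gt0.
move=> P c l M l0 dP nodeM.
have nodeI a (j : 'I_k.+1) : `|a + l * node k j - a| <= r * l.
  rewrite addrC addKr ger0_norm ?mulr_ge0 ?(ltW l0) // /node ?divr_ge0 //.
  rewrite mulrC ler_wpM2r ?(ltW l0) //; apply: le_trans r1.
  by rewrite ler_pdivrMr ?ltr0Sn // mul1r ler_nat ltnW.
have row (i : 'I_k.+1) t : `|t - c.2| <= r * l ->
    `|(slice1 P t).[c.1 + l * node k i]| <= B * M.
  move=> ht; rewrite -[t]/((c.1 + l * node k i, t).2) (slice1E P (c.1 + l * node k i, t)).
  by have [] := uni (slice2 P (c.1 + l * node k i)) c.2 l M l0 (size_slice2 _ dP) (nodeM i) t ht.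
have col (j : 'I_k.+1) t : `|t - c.1| <= r * l ->
    `|(slice2 P t).[c.2 + l * node k j]| <= B * M.
  move=> ht; have nM (i : 'I_k.+1) : `|(slice1 P (c.2 + l * node k j)).[c.1 + l * node k i]| <= M.
    by have := nodeM i j; rewrite -slice1E.
  have [] := uni _ c.1 l M l0 (size_slice1 _ dP) nM t ht.
  by rewrite (slice1E P (t, c.2 + l * node k j)).
move=> x x1 x2.
have [a1 a2 a3] := uni _ c.1 l (B * M) l0 (size_slice1 x.2 dP) (fun i => row i _ x2) x.1 x1.
have [b1 b2 b3] := uni _ c.2 l (B * M) l0 (size_slice2 x.1 dP) (fun j => col j _ x1) x.2 x2.
rewrite slice1E slice1_d1 mulrA in a1 a2; rewrite slice2_d2 mulrA in b2.
split => // y y1 y2.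
have e1 := a3 y.1 y1; rewrite slice1E (slice1E P (y.1, x.2)) mulrA in e1.
have [_ _ f3] := uni _ c.2 l (B * M) l0 (size_slice2 y.1 dP) (fun j => col j _ y1) x.2 x2.
have f1 := f3 y.2 y2; rewrite (slice2E P (y.1, x.2)) slice2E mulrA in f1.
(* The corner [(y.1, x.2)] splits the increment into one along each axis. *)
have -> : peval P x - peval P y =
  (peval P x - peval P (y.1, x.2)) + (peval P (y.1, x.2) - peval P y) by ring.
apply: le_trans (ler_normD _ _) _; rewrite mulrDr mulrDl; exact: lerD.
Qed.

(* By the Lipschitz bound, the Lagrange node where the gradient is largest is
   the centre of a box, of size comparable to [l], on which the gradient keeps
   at least half of its size. *)
Lemma local_inverse k r : 1 <= r -> exists delta kappa : R, [/\ 0 < delta, 0 < kappa &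
  forall P c l, 0 < l -> total_degree_le k P -> exists A c', [/\ 0 <= A,
    forall x, `|x.1 - c.1| <= r * l -> `|x.2 - c.2| <= r * l ->
      [/\ `|peval (d1 P) x| <= A, `|peval (d2 P) x| <= A & `|laplacian P x| <= A / l],
    box c' (delta * l) `<=` box c l &
    forall x, box c' (delta * l) x -> kappa * A <= enorm (grad P x)]].
Proof.
move=> r1; have [B [B0 biv]] := bivariate_inverse k r1.
have k0 : 0 < k.+1%:R :> R by rewrite ltr0Sn.
(* The first bound keeps the box around a node inside [box c l]; the second limits the variation of
   the largest partial derivative on it to [M / 2]. *)
pose delta := Num.min (k.+1%:R^-1) (4 * B)^-1 : R.
have d0 : 0 < delta by rewrite lt_min !invr_gt0 k0 mulr_gt0.
have dk : delta <= k.+1%:R^-1 by rewrite ge_min lexx.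
have dB : delta * (4 * B) <= 1.
  by rewrite -ler_pdivlMr ?mulr_gt0 // div1r ge_min lexx orbT.
exists delta, (4 * B)^-1; split => //; first by rewrite invr_gt0 mulr_gt0.
move=> P c l l0 dP.
pose Q (b : bool) := if b then d1 P else d2 P.
have dQ b : total_degree_le k (Q b).
  by case: b; [exact: total_degree_d1|exact: total_degree_d2].
pose g (i j : 'I_k.+1) : pt R := (c.1 + l * node k i, c.2 + l * node k j).
pose F (u : 'I_k.+1 * 'I_k.+1 * bool) := `|peval (Q u.2) (g u.1.1 u.1.2)|.
case: (@Order.TotalTheory.arg_maxP _ R _ (ord0, ord0, true) xpredT F) => // -[[i0 j0] b0] _ maxF.
pose M := F (i0, j0, b0); have M0 : 0 <= M by exact: normr_ge0.
have QM b i j : `|peval (Q b) (g i j)| <= M by exact: (maxF (i, j, b)).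
(* The factor 2 pays for the two second derivatives in the Laplacian; [kappa * A] then equals
   [M / 2]. *)
exists (2 * B * M), (g i0 j0).
have nodeB (j : 'I_k.+1) : 0 <= (node k j : R) /\ node k j + delta <= 1.
  split; first by rewrite /node divr_ge0.
  apply: (@le_trans _ _ (node k j + k.+1%:R^-1)); first by rewrite lerD2l.
  rewrite /node -[X in _ + X]mul1r -mulrDl ler_pdivrMr // mul1r.
  by rewrite natr1 ler_nat.
have BM : 0 <= B * M by rewrite mulr_ge0 // ltW.
have sub : box (g i0 j0) (delta * l) `<=` box c l.
  move=> x [x1 x2]; have [n1 m1] := nodeB i0; have [n2 m2] := nodeB j0.
  rewrite /= in x1 x2; move: x1 x2; rewrite !ltr_norml => /andP[x1 x1'] /andP[x2 x2'].
  by split; rewrite ltr_norml; apply/andP; split; nra.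
have boxr x : box c l x -> `|x.1 - c.1| <= r * l /\ `|x.2 - c.2| <= r * l.
  by move=> [x1 x2]; split; nra.
split => //; first by lra.
- move=> x x1 x2.
  have [a1 a2 _ _] := biv _ c l M l0 (dQ true) (QM true) x x1 x2.
  have [b1 _ b2 _] := biv _ c l M l0 (dQ false) (QM false) x x1 x2.
  rewrite /= in a1 a2 b1 b2; split; try lra.
  rewrite /laplacian /peval !hornerD -/(peval _ _) -/(peval _ _).
  apply: le_trans (ler_normD _ _) _.
  by have := lerD a2 b2; rewrite -mulrDl; congr (_ <= _ / _); ring.
- move=> x xb; have [x1 x2] := boxr _ (sub _ xb).
  have gb : box c l (g i0 j0).
    by apply: sub; rewrite /box /= !subrr normr0 mulr_gt0.
  have [g1 g2] := boxr _ gb.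
  have [_ _ _ lip] := biv _ c l M l0 (dQ b0) (QM b0) _ g1 g2.
  have := lip x x1 x2; case: xb => xb1 xb2 lipx.
  have xs : `|(g i0 j0).1 - x.1| + `|(g i0 j0).2 - x.2| <= 2 * (delta * l).
    by rewrite (distrC _ x.1) (distrC _ x.2); lra.
  have l1 : B * M * (`|(g i0 j0).1 - x.1| + `|(g i0 j0).2 - x.2|) / l <= M / 2.
    rewrite ler_pdivrMr //; apply: (@le_trans _ _ (B * M * (2 * (delta * l)))).
      by rewrite ler_wpM2l.
    have : 0 <= M * l * (1 - delta * (4 * B)) by rewrite !mulr_ge0 ?(ltW l0) // subr_ge0.
    lra.
  have l2 : M / 2 <= `|peval (Q b0) x|.
    have e : M <= `|peval (Q b0) (g i0 j0) - peval (Q b0) x| + `|peval (Q b0) x|.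
      rewrite -{1}[M]/(`|peval (Q b0) (g i0 j0)|).
      by apply: le_trans (ler_normD _ _); rewrite subrK.
    lra.
  have -> : (4 * B)^-1 * (2 * B * M) = M / 2 by field; exact: lt0r_neq0.
  apply: le_trans l2 _; have [n1 n2] := enorm_ge_coord (grad P x).
  by case: (b0) => /=.
Qed.

End BivariateInverse.
(** * Quadratic norms *)

Section L2Norm.
Context {d : measure_display} {T : measurableType d} {R : realType}.
Variable mu : {measure set T -> \bar R}.
Implicit Types (f g u w : T -> R) (A : set T) (S : R).

Local Notation N2 g := ('N[mu]_2%:E[EFin \o g])%E.

Lemma fine_Lnorm2_sqr g : fine (N2 g) ^+ 2 = fine (\int[mu]_x (g x ^+ 2)%:E)%E.
Proof.
have two0 : (2 : R) != 0 by [].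
rewrite -powR_mulrn ?fine_ge0 ?Lnorm_ge0 // -fine_poweR poweR_Lnorm //.
congr fine; apply: eq_integral => x _ /=.
by rewrite powR_mulrn // real_normK ?num_real.
Qed.

Lemma measurable_sqr g : measurable_fun setT g ->
  measurable_fun setT (EFin \o (fun x => g x ^+ 2 : R)).
Proof. by move=> mg; apply/measurable_EFinP; exact: measurable_funX. Qed.

Lemma integral_sqr_le g A S : measurable_fun setT g -> measurable A ->
  0 <= S -> (forall x, `|g x| <= S * \1_A x) ->
  (\int[mu]_x (g x ^+ 2)%:E <= (S ^+ 2)%:E * mu A)%E.
Proof.
move=> mg mA S0 gA.
apply: (@le_trans _ _ (\int[mu]_x (S ^+ 2 * \1_A x)%:E)%E).
  apply: ge0_le_integral => //.
  - by move=> x _; rewrite lee_fin sqr_ge0.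
  - exact: measurable_sqr.
  - by apply/measurable_EFinP; apply: measurable_funM => //; exact: measurable_indic.
  move=> x _; rewrite lee_fin -[leLHS]real_normK ?num_real //.
  have : `|g x| ^+ 2 <= (S * \1_A x) ^+ 2 by rewrite lerXn2r ?nnegrE // (le_trans _ (gA x)).
  by rewrite exprMn indicE; case: (x \in A); rewrite ?expr1n ?expr0n.
under eq_integral do rewrite EFinM.
have mI : measurable_fun setT (EFin \o (\1_A : T -> R)).
  by apply/measurable_EFinP; exact: measurable_indic.
rewrite (ge0_integralZl mu measurableT mI) ?lee_fin ?sqr_ge0 ?integral_indic ?setIT //.
by move=> x _; rewrite lee_fin.
Qed.

Lemma Lnorm2_lty g : (\int[mu]_x (g x ^+ 2)%:E < +oo)%E -> (N2 g < +oo)%E.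
Proof.
move=> h; apply: (@lty_poweRy _ _ 2) => //; rewrite poweR_Lnorm //.
under eq_integral => x _ do rewrite /= powR_mulrn // real_normK ?num_real //.
exact: h.
Qed.

Lemma Lnorm2_bounded g A S : measurable_fun setT g -> measurable A ->
  (mu A < +oo)%E -> 0 <= S -> (forall x, `|g x| <= S * \1_A x) ->
  [/\ (\int[mu]_x (g x ^+ 2)%:E < +oo)%E, (N2 g < +oo)%E &
      fine (N2 g) <= S * Num.sqrt (fine (mu A))].
Proof.
move=> mg mA fA S0 gA; have le := integral_sqr_le mg mA S0 gA.
have mAE : (mu A = (fine (mu A))%:E)%E by rewrite fineK // ge0_fin_numE.
have fin : (\int[mu]_x (g x ^+ 2)%:E < +oo)%E.
  by apply: le_lt_trans le _; rewrite mAE -EFinM ltry.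
split => //; first exact: Lnorm2_lty.
rewrite -[leLHS]ger0_norm ?fine_ge0 ?Lnorm_ge0 // -sqrtr_sqr fine_Lnorm2_sqr.
rewrite -[S in leRHS]ger0_norm // -sqrtr_sqr -sqrtrM ?sqr_ge0 // ler_wsqrtr //.
rewrite -lee_fin fineK; first by rewrite EFinM -mAE.
by rewrite ge0_fin_numE // integral_ge0 // => x _; rewrite lee_fin sqr_ge0.
Qed.

(** [fine] sends infinity to 0, so both norms must be finite before they are compared; for [u] this
    follows from Minkowski's inequality and the bounded difference. *)
Lemma Lnorm2_diff u w A S : measurable_fun setT u -> measurable_fun setT w ->
  measurable A -> (mu A < +oo)%E -> 0 <= S -> (N2 w < +oo)%E ->
  (forall x, `|u x - w x| <= S * \1_A x) ->
  `|fine (N2 u) - fine (N2 w)| <= S * Num.sqrt (fine (mu A)).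
Proof.
move=> mu_ mw mA fA S0 fw uw.
have wu x : `|w x - u x| <= S * \1_A x by rewrite distrC.
have [_ f1 le1] := Lnorm2_bounded (measurable_funB mu_ mw) mA fA S0 uw.
have [_ f2 le2] := Lnorm2_bounded (measurable_funB mw mu_) mA fA S0 wu.
have one2 : (1 <= 2 :> R) by rewrite ler1n.
have tri (v z : T -> R) : measurable_fun setT v -> measurable_fun setT z ->
    (N2 z < +oo)%E -> (N2 (v \- z)%R < +oo)%E ->
    (N2 v < +oo)%E /\ fine (N2 v) <= fine (N2 (v \- z)%R) + fine (N2 z).
  move=> mv mz fz fvz.
  have := minkowski_EFin mu (measurable_funB mv mz) mz one2.
  have -> : ((v \- z) \+ z)%R = v by apply/funext => x /=; rewrite subrK.
  move=> le; have fv : (N2 v < +oo)%E.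
    by apply: le_lt_trans le _; rewrite lte_add_pinfty.
  have fin_nb z' : (N2 z' < +oo)%E -> N2 z' \is a fin_num.
    by move=> h; rewrite ge0_fin_numE // Lnorm_ge0.
  split => //; move: le; rewrite -(fineK (fin_nb _ fv)) -(fineK (fin_nb _ fvz)).
  by rewrite -(fineK (fin_nb _ fz)) -EFinD lee_fin.
have [fu leu] := tri _ _ mu_ mw fw f1.
have [_ lew] := tri _ _ mw mu_ fu f2.
by rewrite ler_norml; apply/andP; split; lra.
Qed.

(** Integrates a step function lying below [g ^ 2]. The sets will be boxes, so no integral of a
    polynomial has to be computed. *)
Lemma Lnorm2_lower (I : Type) (s : seq I) (a : I -> R) (B : I -> set T) g :
  measurable_fun setT g -> (\int[mu]_x (g x ^+ 2)%:E < +oo)%E ->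
  (forall i, 0 <= a i) -> (forall i, measurable (B i)) -> (forall i, mu (B i) < +oo)%E ->
  (forall x, \sum_(i <- s) a i * \1_(B i) x <= g x ^+ 2) ->
  \sum_(i <- s) a i * fine (mu (B i)) <= fine (N2 g) ^+ 2.
Proof.
move=> mg fin a0 mB fB le.
have mI i : measurable_fun setT (EFin \o (fun x : T => a i * \1_(B i) x : R)).
  by apply/measurable_EFinP; apply: measurable_funM => //; exact: measurable_indic.
rewrite fine_Lnorm2_sqr -lee_fin fineK; last first.
  by rewrite ge0_fin_numE // integral_ge0 // => x _; rewrite lee_fin sqr_ge0.
apply: (@le_trans _ _ (\int[mu]_x (\sum_(i <- s) (a i * \1_(B i) x)%:E))%E).
  rewrite ge0_integral_sum //; last by move=> i x _; rewrite lee_fin mulr_ge0.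
  rewrite -sumEFin le_eqVlt; apply/orP; left; apply/eqP; apply: eq_bigr => i _.
  under eq_integral do rewrite EFinM.
  have mJ : measurable_fun setT (EFin \o (\1_(B i) : T -> R)).
    by apply/measurable_EFinP; exact: measurable_indic.
  rewrite (ge0_integralZl mu measurableT mJ) ?lee_fin ?integral_indic ?setIT //.
    by rewrite EFinM fineK // ge0_fin_numE.
  by move=> x _; rewrite lee_fin.
apply: ge0_le_integral => //.
- by move=> x _; rewrite sume_ge0 // => i _; rewrite lee_fin mulr_ge0.
- by apply: emeasurable_sum => i; exact: mI.
- exact: measurable_sqr.
- by move=> x _; rewrite sumEFin lee_fin.
Qed.

End L2Norm.
(** * Norms over triangles and edges *)

Section PlanarMeasure.
Context {R : realType}.
Implicit Types (a b c x y z : pt R) (K E : cell R) (p : {poly R}).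
Implicit Types (P Q : {poly {poly R}}) (S M : R) (Omega : set (pt R)).

Local Notation pm := (measurableTypeR R * measurableTypeR R)%type.
Local Notation mfun2 f := (measurable_fun [set: pm] (f : pm -> R)).

Lemma measurable_horner p : measurable_fun [set: R] (horner p).
Proof.
elim/poly_ind: p => [|p a IH].
  rewrite (_ : horner 0 = cst 0); first exact: measurable_cst.
  by apply/funext => s; rewrite horner0.
rewrite (_ : horner _ = (fun s => p.[s] * s + a)).
  by apply: measurable_funD => //; apply: measurable_funM.
by apply/funext => s; rewrite !hornerE.
Qed.

Lemma peval_MXaddC P p x : peval (P * 'X + p%:P) x = peval P x * x.1 + p.[x.2].
Proof. by rewrite /peval !hornerE. Qed.

Lemma measurable_peval P : mfun2 (peval P).
Proof.
elim/poly_ind: P => [|P p IH].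
  rewrite (_ : peval 0 = cst 0); first exact: measurable_cst.
  by apply/funext => x; rewrite /peval !horner0.
rewrite (_ : peval _ = (fun x => peval P x * x.1 + p.[x.2])).
  apply: measurable_funD; first by apply: measurable_funM => //; exact: measurable_fst.
  by apply: (measurableT_comp (measurable_horner p)); exact: measurable_snd.
by apply/funext => x; rewrite peval_MXaddC.
Qed.

Lemma peval_bounded P M : exists S, 0 <= S /\
  forall x, `|x.1| <= M -> `|x.2| <= M -> `|peval P x| <= S.
Proof.
elim/poly_ind: P => [|P p [S [S0 hS]]].
  by exists 0; split => // x _ _; rewrite /peval !horner0 normr0.
have [B [B0 hB]] := poly_bound_lipschitz p (normr_ge0 M).
exists (S * `|M| + B); split; first by rewrite addr_ge0 // mulr_ge0.
move=> x x1 x2; rewrite peval_MXaddC; apply: le_trans (ler_normD _ _) _.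
rewrite normrM; apply: lerD.
  by apply: ler_pM => //; [exact: hS|exact: le_trans x1 (ler_norm _)].
by have [] := hB x.2 (le_trans x2 (ler_norm _)).
Qed.

Lemma measurable_bary a b c : mfun2 (bary a b c).
Proof.
pose D := det3 a b c.
rewrite (_ : bary a b c = fun y : pm =>
    (- (c.1 - b.1) * b.2 + (c.2 - b.2) * b.1) / D
    + (- (c.2 - b.2) / D) * y.1 + ((c.1 - b.1) / D) * y.2); last first.
  by apply/funext => y; rewrite baryE det3E -/D; ring.
apply: measurable_funD; first apply: measurable_funD => //.
  by apply: measurable_funM => //; exact: measurable_fst.
by apply: measurable_funM => //; exact: measurable_snd.
Qed.

Lemma measurable_hull K : is_triangle K -> measurable (hull K : set pm).
Proof.
move=> [a [b [c [-> h]]]].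
have m3 (u v w : pt R) : measurable ([set x | 0 <= bary u v w x] : set pm).
  have := measurable_bary u v w measurableT (measurable_itv `[0, +oo[).
  rewrite setTI; congr (measurable _); apply/seteqP.
  by split => x /=; rewrite in_itv /= andbT.
rewrite (_ : hull _ = [set x | 0 <= bary a b c x] `&` [set x | 0 <= bary b c a x]
    `&` [set x | 0 <= bary c a b x]).
  by apply: measurableI => //; exact: measurableI.
by apply/seteqP; split => x; [move/(hull3P _ h) => []|case=> -[] *; apply/(hull3P _ h)].
Qed.

(** An interior point with a vanishing coordinate could be pushed slightly away from the vertex of
    that coordinate, which would make it negative inside the triangle. *)
Lemma interior_hullE a b c : det3 a b c != 0 -> interior (hull [fset a; b; c]%fset) =
  [set x | 0 < bary a b c x] `&` [set x | 0 < bary b c a x]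
    `&` [set x | 0 < bary c a b x].
Proof.
move=> h; apply/seteqP; split => x; last first.
  move=> [[x1 x2] x3]; rewrite /interior /=; near=> y.
  by apply/(hull3P _ h); split; apply: ltW; near: y; exact: bary_near_pos.
have out (p q r z : pt R) : bary p q r z = 1 ->
    (forall y, hull [fset a; b; c]%fset y -> 0 <= bary p q r y) ->
    interior (hull [fset a; b; c]%fset) x -> 0 < bary p q r x.
  move=> bz pos ix; rewrite lt_neqAle pos ?andbT; last exact: interior_subset.
  apply/eqP => b0.
  have /filter_ex[e [e0 he]] : \forall e \near 0^'+, 0 < e /\
      hull [fset a; b; c]%fset (x + e *: (x - z)).
    by near=> e; split => //; near: e; exact: interior_ray.
  have := pos _ he; have -> : x + e *: (x - z) = (1 + e) *: x + (- e) *: z.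
    by rewrite scalerDl scale1r scalerBr scaleNr addrA.
  by rewrite bary_affine ?addrK // -b0 bz mulr0 add0r mulr1 oppr_ge0 leNgt e0.
have h1 : det3 b c a != 0 by rewrite (det3_rot a b c).
have h2 : det3 c a b != 0 by rewrite -(det3_rot c a b).
have [e0 _ _] := bary_id h; have [e1 _ _] := bary_id h1.
have [e2 _ _] := bary_id h2.
move=> ix; split; first split.
- by apply: (out _ _ _ _ e0 _ ix) => y /(hull3P _ h)[].
- by apply: (out _ _ _ _ e1 _ ix) => y /(hull3P _ h)[].
- by apply: (out _ _ _ _ e2 _ ix) => y /(hull3P _ h)[].
Unshelve. all: by end_near. Qed.

Lemma measurable_interior_hull K : is_triangle K -> measurable (interior (hull K) : set pm).
Proof.
move=> [a [b [c [-> h]]]]; rewrite interior_hullE //.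
have m3 (u v w : pt R) : measurable ([set x | 0 < bary u v w x] : set pm).
  have := measurable_bary u v w measurableT (measurable_itv `]0, +oo[).
  rewrite setTI; congr (measurable _); apply/seteqP.
  by split => x /=; rewrite in_itv /= andbT.
by apply: measurableI => //; exact: measurableI.
Qed.

Lemma box_prod c l : box c l = `]c.1 - l, c.1 + l[%classic `*` `]c.2 - l, c.2 + l[%classic.
Proof.
by apply/seteqP; split => x; rewrite /box /= !in_itv /= -!ltr_distl.
Qed.

Lemma measurable_box c l : measurable (box c l : set pm).
Proof. by rewrite box_prod; apply: measurableX; exact: measurable_itv. Qed.

Lemma leb2_box c (l : R) : 0 < l -> leb2 (box c l) = ((2 * l) ^+ 2)%:E.
Proof.
move=> l0; rewrite box_prod -[leb2 _]/((@lebesgue_measure R \x @lebesgue_measure R)%E _).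
rewrite product_measure1E; try exact: measurable_itv.
transitivity (lebesgue_measure (`](c.1 - l)%R, (c.1 + l)%R[%classic : set R) *
  lebesgue_measure (`](c.2 - l)%R, (c.2 + l)%R[%classic : set R))%E; first by [].
rewrite !lebesgue_measure_itv /= !lte_fin !ltrD2l !gtrN // -!EFinB -EFinM.
by congr EFin; ring.
Qed.

Lemma area_bound K c (h : R) : is_triangle K -> 0 < h ->
  (forall x, hull K x -> `|x.1 - c.1| <= h /\ `|x.2 - c.2| <= h) ->
  (leb2 (hull K) < +oo)%E /\ Num.sqrt (area K) <= 4 * h.
Proof.
move=> tK h0 hK; have h2 : 0 < 2 * h by lra.
have le : (leb2 (hull K) <= ((2 * (2 * h)) ^+ 2)%:E)%E.
  rewrite -(leb2_box c h2); apply: le_measure; rewrite ?inE.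
  - exact: measurable_hull.
  - exact: measurable_box.
  - by move=> x /hK[x1 x2]; split; lra.
have fin : (leb2 (hull K) < +oo)%E by apply: le_lt_trans le _; rewrite ltry.
split => //; rewrite (_ : 4 * h = Num.sqrt ((2 * (2 * h)) ^+ 2)).
  by rewrite ler_wsqrtr // -lee_fin /area fineK // ge0_fin_numE.
by rewrite sqrtr_sqr ger0_norm; lra.
Qed.

Lemma hull_leb2_lty K : is_triangle K -> (leb2 (hull K) < +oo)%E.
Proof.
move=> tK; have [M hM] := hull_bounded tK.
have M1 : 0 < `|M| + 1 by rewrite ltr_wpDl.
have [|//] := @area_bound K 0 (`|M| + 1) tK M1.
by move=> x /hM[x1 x2]; rewrite !subr0; have := ler_norm M; lra.
Qed.

(** [f] cancels in the difference; its square integrability enters through the measurability and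
    finiteness of the norms. *)
Lemma cell_norm_diff Omega (f : pt R -> R) P Q K S : is_triangle K ->
  f \_ Omega \in Lfun leb2 2%:E -> 0 <= S ->
  (forall x, hull K x -> `|laplacian P x - laplacian Q x| <= S) ->
  `|L2norm (hull K) (fun x => (f \_ Omega) x + laplacian P x)
    - L2norm (hull K) (fun x => (f \_ Omega) x + laplacian Q x)|
  <= S * Num.sqrt (area K).
Proof.
move=> tK /andP[]; rewrite !inE => /= mf ff S0 hS.
have mh := measurable_hull tK; have fh := hull_leb2_lty tK.
have mL U : mfun2 (fun x => (f \_ Omega) x + laplacian U x).
  by apply: measurable_funD => //; exact: measurable_peval.
have mR U : mfun2 ((fun x => (f \_ Omega) x + laplacian U x) \_ (hull K)).
  by apply: (measurable_restrictT _ mh).1; apply: measurable_funTS; exact: mL.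
apply: Lnorm2_diff => //; last first.
  move=> x; rewrite indicE patchE patchE.
  case: ifPn => xK; last by rewrite subrr normr0 mulr0.
  by rewrite mulr1 opprD addrACA subrr add0r; apply: hS; rewrite inE in xK.
(* Cut off outside [K], the Laplacian is square integrable on the plane, so its sum with [f] has
   finite norm by Minkowski's inequality. *)
pose w0 : pm -> R := (laplacian Q) \_ (hull K).
have mw0 : mfun2 w0.
  by apply: (measurable_restrictT _ mh).1; apply: measurable_funTS; exact: measurable_peval.
have [M hM] := hull_bounded tK.
have [B [B0 hB]] := peval_bounded (d1 (d1 Q) + d2 (d2 Q)) M.
have [_ fw0 _] : [/\ (\int[leb2]_x (w0 x ^+ 2)%:E < +oo)%E,
    ('N[leb2]_2%:E[EFin \o w0] < +oo)%E &
    fine ('N[leb2]_2%:E[EFin \o w0]) <= B * Num.sqrt (fine (leb2 (hull K)))].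
  apply: Lnorm2_bounded => // x; rewrite /w0 indicE patchE.
  case: ifPn => xK; last by rewrite normr0 mulr0.
  by rewrite mulr1; rewrite inE in xK; have [x1 x2] := hM _ xK; exact: hB.
have fsum : ('N[leb2]_2%:E[EFin \o ((f \_ Omega) \+ w0)%R] < +oo)%E.
  apply: le_lt_trans (minkowski_EFin _ mf mw0 _) _; first by rewrite ler1n.
  by rewrite lte_add_pinfty.
have := poweR_lty 2 fsum; rewrite poweR_Lnorm // => isum.
apply: Lnorm2_lty; apply: le_lt_trans isum.
apply: ge0_le_integral => //.
- by move=> x _; rewrite lee_fin sqr_ge0.
- exact: measurable_sqr.
- under eq_fun => x do rewrite /= powR_mulrn // real_normK ?num_real //.
  by apply: measurable_sqr; exact: measurable_funD.
- move=> x _; rewrite /= powR_mulrn // real_normK ?num_real // lee_fin /w0 !patchE.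
  by case: ifPn => // _; rewrite expr0n sqr_ge0.
Qed.

(** Turns an edge norm into a norm on a measure space, to which the comparison of norms applies. *)
Lemma edge_L2normE (o : cell R -> pt R * pt R) E (g : pt R -> R) :
  edge_L2norm o E g = Num.sqrt (elen o E) *
    fine ('N[lebesgue_measure]_2%:E[EFin \o ((g \o epoint o E) \_ `[0%R, 1%R])])%E.
Proof.
rewrite /edge_L2norm /edge_integral /Rintegral sqrtrM ?enorm_ge0 //; congr (_ * _).
rewrite -[RHS]ger0_norm ?fine_ge0 ?Lnorm_ge0 // -sqrtr_sqr; congr Num.sqrt.
rewrite fine_Lnorm2_sqr integral_mkcond; congr fine.
apply: eq_integral => t _; rewrite !patchE; case: ifP => // _.
by rewrite expr0n.
Qed.

Lemma edge_norm_diff (o : cell R -> pt R * pt R) E P Q (g1 g2 : pt R -> R) S : 0 <= S ->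
  g1 =1 peval P -> g2 =1 peval Q ->
  (forall t, 0 <= t <= 1 -> `|g1 (epoint o E t) - g2 (epoint o E t)| <= S) ->
  `|edge_L2norm o E g1 - edge_L2norm o E g2| <= Num.sqrt (elen o E) * S.
Proof.
move=> S0 /funext -> /funext -> hS.
rewrite !edge_L2normE -mulrBr normrM ger0_norm ?sqrtr_ge0 // ler_wpM2l ?sqrtr_ge0 //.
have mI : measurable (`[0, 1]%classic : set (measurableTypeR R)) by exact: measurable_itv.
have mep : measurable_fun [set: measurableTypeR R] (epoint o E : _ -> pm).
  by apply: measurable_fun_pair; apply: measurable_funD => //; apply: measurable_funM.
have mg U : measurable_fun [set: measurableTypeR R] ((peval U \o epoint o E) \_ `[0%R, 1%R]).
  apply: (measurable_restrictT _ mI).1; apply: measurable_funTS.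
  exact: measurableT_comp (measurable_peval U) mep.
have I1 : lebesgue_measure (`[0%R, 1%R]%classic : set R) = 1%E.
  by rewrite lebesgue_measure_itv /= lte_fin ltr01 -EFinB subr0.
have -> : S = S * Num.sqrt (fine (lebesgue_measure (`[0%R, 1%R]%classic : set R))).
  by rewrite I1 /= sqrtr1 mulr1.
have fI : (lebesgue_measure (`[0%R, 1%R]%classic : set R) < +oo)%E by rewrite I1 ltry.
apply: Lnorm2_diff => //; last first.
  move=> t; rewrite indicE !patchE; case: ifPn => tI; last by rewrite subrr normr0 mulr0.
  by rewrite mulr1; apply: hS; rewrite inE /= in_itv in tI.
pose M := `|(o E).1.1| + `|(o E).2.1 - (o E).1.1| + (`|(o E).1.2| + `|(o E).2.2 - (o E).1.2|).
have [B [B0 hB]] := peval_bounded Q M.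
have [] // := @Lnorm2_bounded _ _ _ lebesgue_measure _ _ _ (mg Q) mI fI B0 _.
move=> t; rewrite indicE patchE; case: ifPn => tI; last by rewrite normr0 mulr0.
rewrite mulr1; apply: hB.
all: rewrite inE /= in_itv in tI; case/andP: tI => t0 t1.
all: apply: le_trans (ler_normD _ _) _ => /=.
all: rewrite (normrM t) (ger0_norm t0).
  have := ler_piMl (normr_ge0 ((o E).2.1 - (o E).1.1)) t1.
  have := normr_ge0 (o E).1.2; have := normr_ge0 ((o E).2.2 - (o E).1.2).
  by rewrite /M; lra.
have := ler_piMl (normr_ge0 ((o E).2.2 - (o E).1.2)) t1.
have := normr_ge0 (o E).1.1; have := normr_ge0 ((o E).2.1 - (o E).1.1).
by rewrite /M; lra.
Qed.

End PlanarMeasure.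
(** * The piecewise gradient *)

Section PiecewiseGradient.
Context {R : realType}.
Implicit Types (x y : pt R) (K : cell R) (T : {fset cell R}).
Implicit Types (v : cell R -> {poly {poly R}}) (S M : R).

Local Notation pm := (measurableTypeR R * measurableTypeR R)%type.
Local Notation mfun2 f := (measurable_fun [set: pm] (f : pm -> R)).

Lemma pgrad1E T v x : (pgrad T v x).1 =
  \sum_(K <- T) (peval (d1 (v K)) \_ (interior (hull K))) x.
Proof.
rewrite /pgrad (big_morph fst (id1 := 0) (op1 := +%R)) //.
by apply: eq_bigr => K _; rewrite !patchE; case: ifP.
Qed.

Lemma pgrad2E T v x : (pgrad T v x).2 =
  \sum_(K <- T) (peval (d2 (v K)) \_ (interior (hull K))) x.
Proof.
rewrite /pgrad (big_morph snd (id1 := 0) (op1 := +%R)) //.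
by apply: eq_bigr => K _; rewrite !patchE; case: ifP.
Qed.

Lemma measurable_piecewise (s : seq (cell R)) (F : cell R -> {poly {poly R}}) :
  (forall K, K \in s -> is_triangle K) ->
  mfun2 (fun x => \sum_(K <- s) (peval (F K) \_ (interior (hull K))) x).
Proof.
elim: s => [|K s IH] tri.
  by under eq_fun do rewrite big_nil; exact: measurable_cst.
under eq_fun do rewrite big_cons.
apply: measurable_funD; last by apply: IH => K' K's; apply: tri; rewrite inE K's orbT.
apply: (measurable_restrictT _ (measurable_interior_hull (tri _ (mem_head _ _)))).1.
by apply: measurable_funTS; exact: measurable_peval.
Qed.

Lemma piecewise_bounded (s : seq (cell R)) (F : cell R -> {poly {poly R}}) M :
  (forall K x, K \in s -> hull K x -> `|x.1| <= M /\ `|x.2| <= M) ->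
  exists S, 0 <= S /\
    forall x, `|\sum_(K <- s) (peval (F K) \_ (interior (hull K))) x| <= S.
Proof.
elim: s => [|K s IH] hM; first by exists 0; split => // x; rewrite big_nil normr0.
have [|S [S0 hS]] := IH; first by move=> K' x K's; apply: hM; rewrite inE K's orbT.
have [B [B0 hB]] := peval_bounded (F K) M.
exists (B + S); split; first exact: addr_ge0.
move=> x; rewrite big_cons; apply: le_trans (ler_normD _ _) _; apply: lerD => //.
rewrite patchE; case: ifPn => xK; last by rewrite normr0.
rewrite inE in xK; have [x1 x2] := hM K x (mem_head _ _) (interior_subset xK).
exact: hB.
Qed.

Lemma pgrad_interior Omega T v K x : triangulation Omega T -> K \in T ->
  interior (hull K) x -> pgrad T v x = grad (v K) x.
Proof.
move=> [tri _ conf] KT ix; rewrite /pgrad (big_fsetD1 K) //= big1_fset ?addr0.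
  by rewrite patchE mem_set.
move=> K'; rewrite in_fsetD1 => /andP[ne K'T] _; rewrite patchE memNset // => ix'.
by move/eqP: ne; apply; exact: (interior_unique conf K'T KT ix' ix).
Qed.

Lemma pgrad_outside Omega T v x : polygonal_lipschitz_domain Omega ->
  triangulation Omega T -> ~ Omega x -> pgrad T v x = 0.
Proof.
move=> domO triT nx; rewrite /pgrad big1_fset // => K KT _.
by rewrite patchE memNset // => /(interior_hull_domain domO triT KT).
Qed.

Lemma mesh_bounded Omega T : triangulation Omega T ->
  exists M, 0 < M /\ forall K x, K \in T -> hull K x -> `|x.1| <= M /\ `|x.2| <= M.
Proof.
case=> tri _ _; suff [M [M0 hM]] : exists M, 0 <= M /\
    forall K x, K \in enum_fset T -> hull K x -> `|x.1| <= M /\ `|x.2| <= M.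
  exists (M + 1); split; first by rewrite ltr_wpDl.
  by move=> K x KT /(hM _ _ KT)[x1 x2]; lra.
have {}tri : forall K, K \in enum_fset T -> is_triangle K by exact: tri.
elim: (enum_fset T) tri => [|K s IH] tri; first by exists 0.
have [|M [M0 hM]] := IH; first by move=> K' K's; apply: tri; rewrite inE K's orbT.
have [M' hM'] := hull_bounded (tri _ (mem_head _ _)).
exists (`|M'| + M); split; first by rewrite addr_ge0.
have := ler_norm M'; have := normr_ge0 M' => n0 n1 K' x.
rewrite inE => /orP[/eqP ->|K's] hx; first by have [] := hM' _ hx; lra.
by have [] := hM _ _ K's hx; lra.
Qed.

Lemma measurable_pgrad_diff Omega T That v vhat : triangulation Omega T ->
  triangulation Omega That ->
  mfun2 (fun x => enorm (pgrad T v x - pgrad That vhat x)).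
Proof.
move=> [tri _ _] [trih _ _].
have msq : measurable_fun [set: R] (@Num.sqrt R).
  by apply: continuous_measurable_fun; exact: sqrt_continuous.
apply: (measurableT_comp msq); rewrite /dot.
have m1 : mfun2 (fun x => (pgrad T v x - pgrad That vhat x).1).
  rewrite (_ : (fun x : pm => _) = fun x : pm =>
    (\sum_(K <- T) (peval (d1 (v K)) \_ (interior (hull K))) x) -
    (\sum_(K <- That) (peval (d1 (vhat K)) \_ (interior (hull K))) x)).
    by apply: measurable_funB; exact: measurable_piecewise.
  by apply/funext => x; rewrite -!pgrad1E.
have m2 : mfun2 (fun x => (pgrad T v x - pgrad That vhat x).2).
  rewrite (_ : (fun x : pm => _) = fun x : pm =>
    (\sum_(K <- T) (peval (d2 (v K)) \_ (interior (hull K))) x) -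
    (\sum_(K <- That) (peval (d2 (vhat K)) \_ (interior (hull K))) x)).
    by apply: measurable_funB; exact: measurable_piecewise.
  by apply/funext => x; rewrite -!pgrad2E.
by apply: measurable_funD; exact: measurable_funM.
Qed.

Lemma pgrad_bounded Omega T v : polygonal_lipschitz_domain Omega ->
  triangulation Omega T -> exists S, 0 <= S /\ forall x, enorm (pgrad T v x) <= S.
Proof.
move=> domO triT; have [M [_ hM]] := mesh_bounded triT.
have [S1 [S10 h1]] := piecewise_bounded (fun K => d1 (v K)) hM.
have [S2 [S20 h2]] := piecewise_bounded (fun K => d2 (v K)) hM.
exists (S1 + S2); split; first exact: addr_ge0.
move=> x; apply: le_trans (enorm_le_coord _) _; rewrite pgrad1E pgrad2E.
exact: lerD.
Qed.

(** The sets [B K] lie in the interiors of distinct triangles, so they are disjoint; on each, the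
    piecewise gradients differ by the gradient of one polynomial. *)
Lemma pgrad_diff_lower Omega T That v vhat (par : cell R -> cell R)
    (a : cell R -> R) (B : cell R -> set (pt R)) :
  polygonal_lipschitz_domain Omega ->
  triangulation Omega T -> triangulation Omega That ->
  (forall K, K \in That -> par K \in T) ->
  (forall K, K \in That -> hull K `<=` hull (par K)) ->
  (forall K, 0 <= a K) -> (forall K, measurable (B K : set pm)) ->
  (forall K, leb2 (B K) < +oo)%E ->
  (forall K, K \in That -> B K `<=` interior (hull K)) ->
  (forall K x, K \in That -> B K x -> a K <= enorm (grad (v (par K) - vhat K) x)) ->
  \sum_(K <- That) a K ^+ 2 * fine (leb2 (B K)) <=
    L2norm Omega (fun x => enorm (pgrad T v x - pgrad That vhat x)) ^+ 2.
Proof.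
move=> domO triT triTh parT par_hull a0 mB fB subB leB.
set g := fun x => enorm _.
have mg : mfun2 g by exact: measurable_pgrad_diff triT triTh.
have enorm0 : enorm (0 : pt R) = 0 by rewrite -(scale0r 0) enormZ normr0 mul0r.
have g0 x : ~ Omega x -> g x = 0.
  move=> nx; rewrite /g (pgrad_outside v domO triT nx).
  by rewrite (pgrad_outside vhat domO triTh nx) subrr enorm0.
(* Both piecewise gradients vanish off [Omega], so the norm may be taken over the whole plane. *)
rewrite /L2norm (_ : g \_ Omega = g); last first.
  apply/funext => x; rewrite patchE; case: ifPn => // nx.
  by rewrite g0 // => Ox; move: nx; rewrite mem_set.
have [M [M0 hM]] := mesh_bounded triT; have [Mh [Mh0 hMh]] := mesh_bounded triTh.
have fin : (\int[leb2]_x (g x ^+ 2)%:E < +oo)%E.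
  have [S1 [S10 h1]] := pgrad_bounded v domO triT.
  have [S2 [S20 h2]] := pgrad_bounded vhat domO triTh.
  have S12 : 0 <= 2 * (S1 + S2) by lra.
  have M2 : 0 < 2 * M by lra.
  have [] // := @Lnorm2_bounded _ _ _ leb2 g (box 0 (2 * M)) _ mg (measurable_box _ _) _ S12 _.
    by rewrite leb2_box // ltry.
  move=> x; rewrite /g ger0_norm ?enorm_ge0 // indicE.
  case: (boolP (x \in box 0 (2 * M))) => xb.
    rewrite mulr1; apply: le_trans (enorm_le_coord _) _ => /=.
    have [p1 p2] := enorm_ge_coord (pgrad T v x).
    have [q1 q2] := enorm_ge_coord (pgrad That vhat x).
    have := ler_normB (pgrad T v x).1 (pgrad That vhat x).1.
    have := ler_normB (pgrad T v x).2 (pgrad That vhat x).2.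
    have := h1 x; have := h2 x; lra.
  rewrite mulr0 -/(g x) g0 // => Ox; move/negP: xb; apply; rewrite mem_set //.
  have : closure Omega x by exact: subset_closure.
  case: (triT) => _ <- _ [K /= KT /(hM _ _ KT)[x1 x2]].
  by split => /=; rewrite subr0; lra.
apply: Lnorm2_lower => // [K|x]; first exact: sqr_ge0.
have [[K KTh BK]|none] := pselect (exists2 K, K \in That & B K x); last first.
  rewrite big1_fset ?sqr_ge0 // => K KTh _; rewrite indicE memNset ?mulr0 // => BK.
  by apply: none; exists K.
have ix := subB _ KTh _ BK.
have ipx : interior (hull (par K)) x by apply: filterS ix; exact: par_hull.
have [_ _ confh] := triTh.
rewrite (big_fsetD1 K) //= big1_fset ?addr0 => [|K']; last first.
  rewrite in_fsetD1 => /andP[ne K'T] _; rewrite indicE memNset ?mulr0 // => BK'.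
  by move/eqP: ne; apply; exact: (interior_unique confh K'T KTh (subB _ K'T _ BK') ix).
rewrite indicE mem_set // mulr1 lerXn2r ?nnegrE ?enorm_ge0 //.
rewrite /g (pgrad_interior v triT (parT _ KTh) ipx) (pgrad_interior vhat triTh KTh ix) -gradB.
exact: leB.
Qed.

End PiecewiseGradient.
(** * Comparison of the estimators *)

Section SquareRootDistance.
Context {R : realType}.
Implicit Types (X Y Z a b c z : R).

(* For the squares of two norms this is the reverse triangle inequality, in a
   form that can be summed (by Cauchy-Schwarz). *)
Definition sqrt_close X Y Z :=
  [/\ 0 <= X, 0 <= Y & (Num.sqrt X - Num.sqrt Y) ^+ 2 <= Z].

Lemma sqrt_close0 : sqrt_close 0 0 0.
Proof. by split=> //; rewrite subrr expr0n. Qed.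

Lemma sqrt_closeD X1 Y1 Z1 X2 Y2 Z2 : sqrt_close X1 Y1 Z1 -> sqrt_close X2 Y2 Z2 ->
  sqrt_close (X1 + X2) (Y1 + Y2) (Z1 + Z2).
Proof.
move=> [X10 Y10 h1] [X20 Y20 h2]; have X0 := addr_ge0 X10 X20; have Y0 := addr_ge0 Y10 Y20.
split => //; apply: le_trans (lerD h1 h2).
(* Cauchy-Schwarz in the plane; after squaring, the gap is [(p * s - q * r) ^ 2]. *)
have CS : Num.sqrt X1 * Num.sqrt Y1 + Num.sqrt X2 * Num.sqrt Y2 <=
    Num.sqrt (X1 + X2) * Num.sqrt (Y1 + Y2).
  rewrite -(@ler_pXn2r _ 2) ?nnegrE ?addr_ge0 ?mulr_ge0 ?sqrtr_ge0 //.
  rewrite exprMn !sqr_sqrtr // -[in leRHS](sqr_sqrtr X10) -[in leRHS](sqr_sqrtr X20).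
  rewrite -[in leRHS](sqr_sqrtr Y10) -[in leRHS](sqr_sqrtr Y20).
  move: (Num.sqrt X1) (Num.sqrt X2) (Num.sqrt Y1) (Num.sqrt Y2) => p q r s.
  have := sqr_ge0 (p * s - q * r); nra.
have e U W : 0 <= U -> 0 <= W ->
    (Num.sqrt U - Num.sqrt W) ^+ 2 = U + W - 2 * (Num.sqrt U * Num.sqrt W).
  by move=> U0 W0; rewrite sqrrB !sqr_sqrtr //; ring.
by rewrite !e //; lra.
Qed.

Lemma sqrt_closeZ c X Y Z : 0 <= c -> sqrt_close X Y Z -> sqrt_close (c * X) (c * Y) (c * Z).
Proof.
move=> c0 [X0 Y0 h]; split; try exact: mulr_ge0.
by rewrite !sqrtrM // -mulrBr exprMn sqr_sqrtr // ler_wpM2l.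
Qed.

Lemma sqrt_close_sqr a b z Z : 0 <= a -> 0 <= b -> `|a - b| <= z -> z ^+ 2 <= Z ->
  sqrt_close (a ^+ 2) (b ^+ 2) Z.
Proof.
move=> a0 b0 abz zZ; split; try exact: sqr_ge0.
rewrite !sqrtr_sqr !ger0_norm //; apply: le_trans zZ.
by rewrite -real_normK ?num_real // lerXn2r ?nnegrE // (le_trans _ abz).
Qed.

Lemma sqrt_close_le X Y Z Z' : Z <= Z' -> sqrt_close X Y Z -> sqrt_close X Y Z'.
Proof. by move=> ZZ [X0 Y0 h]; split => //; exact: le_trans h ZZ. Qed.

Lemma sqrt_close_sum (I : eqType) (s : seq I) (P : pred I) (F G H : I -> R) :
  (forall i, i \in s -> P i -> sqrt_close (F i) (G i) (H i)) ->
  sqrt_close (\sum_(i <- s | P i) F i) (\sum_(i <- s | P i) G i) (\sum_(i <- s | P i) H i).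
Proof.
move=> h; rewrite big_seq_cond [X in sqrt_close _ X _]big_seq_cond.
rewrite [X in sqrt_close _ _ X]big_seq_cond.
apply: big_ind3; first exact: sqrt_close0.
  by move=> *; exact: sqrt_closeD.
by move=> i /andP[]; exact: h.
Qed.

Lemma sqrt_close_dist X Y Z : sqrt_close X Y Z -> `|Num.sqrt X - Num.sqrt Y| <= Num.sqrt Z.
Proof. by move=> [X0 Y0 h]; rewrite -sqrtr_sqr ler_wsqrtr. Qed.

End SquareRootDistance.

Section Estimates.
Context {R : realType}.
Implicit Types (c x y n : pt R) (K E : cell R) (T : {fset cell R}).
Implicit Types (v : cell R -> {poly {poly R}}) (P Q : {poly {poly R}}).

Definition dir_deriv n P : {poly {poly R}} :=
  n.1%:P%:P * d1 P + n.2%:P%:P * d2 P.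

Lemma peval_dir_deriv n P x : peval (dir_deriv n P) x = dot (grad P x) n.
Proof. by rewrite /peval /dir_deriv /dot !hornerE mulrC [X in _ + X]mulrC. Qed.

(** A jump in a fixed direction is the restriction of one polynomial on the plane, which makes it
    measurable and bounded along the edge. *)
Lemma jump_dir (Omega : set (pt R)) T o v E n : exists P,
  (fun x => dot (grad_jump Omega T o v E x) n) =1 peval P.
Proof.
rewrite /grad_jump /jump; case: asboolP => _.
  by exists (dir_deriv n (v (KL Omega T o E))) => x; rewrite peval_dir_deriv.
exists (dir_deriv n (v (KL Omega T o E) - v (KR T o E))) => x.
by rewrite peval_dir_deriv gradB.
Qed.

Lemma tangent_coord (o : cell R -> pt R * pt R) E : (o E).1 != (o E).2 ->
  `|(tangent o E).1| <= 1 /\ `|(tangent o E).2| <= 1.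
Proof.
move=> ne; have len0 : 0 < elen o E by apply: enorm_gt0; rewrite subr_eq0 eq_sym.
have e : enorm (tangent o E) = 1.
  by rewrite /tangent enormZ gtr0_norm ?invr_gt0 // mulVf // gt_eqF.
by have := enorm_ge_coord (tangent o E); rewrite e.
Qed.

Lemma dot_bound n x (A : R) : `|n.1| <= 1 -> `|n.2| <= 1 -> `|x.1| <= A -> `|x.2| <= A ->
  `|dot x n| <= 2 * A.
Proof.
move=> n1 n2 x1 x2; rewrite /dot; apply: le_trans (ler_normD _ _) _; rewrite !normrM.
have e1 := ler_pM (normr_ge0 _) (normr_ge0 _) x1 n1.
have e2 := ler_pM (normr_ge0 _) (normr_ge0 _) x2 n2.
lra.
Qed.

Lemma sum_filter_sym (I : choiceType) (A B : {fset I}) (F : I -> R) :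
  \sum_(E <- A | E \in B) F E = \sum_(E <- B | E \in A) F E.
Proof.
rewrite -big_filter -[RHS]big_filter; apply: perm_big; apply: uniq_perm.
- by rewrite filter_uniq ?fset_uniq.
- by rewrite filter_uniq ?fset_uniq.
- by move=> E; rewrite !mem_filter andbC.
Qed.

End Estimates.

(** * Local and global comparison on two nested meshes *)

Section TwoMeshEstimate.
Context {R : realType}.
Implicit Types (x y n : pt R) (K E Kh : cell R).
Variables (Omega : set (pt R)) (o : cell R -> pt R * pt R).
Variables (T That : {fset cell R}) (par : cell R -> cell R).
Hypothesis domO : polygonal_lipschitz_domain Omega.
Hypothesis triT : triangulation Omega T.
Hypothesis triTh : triangulation Omega That.
Hypothesis orT : orientation Omega T o.
Hypothesis orTh : orientation Omega That o.
Hypothesis parT : forall K, K \in That -> par K \in T.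
Hypothesis par_hull : forall K, K \in That -> hull K `<=` hull (par K).
Variables (v vhat : cell R -> {poly {poly R}}) (f : pt R -> R).
Hypothesis fL2 : f \_ Omega \in Lfun leb2 2%:E.

(** The triangles for which shape regularity is available; every triangle of [That] having an edge
    of the mesh [T] is one of them. *)
Let touching K := K \in That /\ exists2 E, E \in edges K & E \in edges (par K).

Variables (r : R) (l A : cell R -> R).
Hypothesis r1 : 1 <= r.
Hypothesis l_gt0 : forall K, 0 < l K.
Hypothesis A_ge0 : forall K, 0 <= A K.
Hypothesis size_le : forall K, touching K ->
  forall x y, hull K x -> hull K y -> enorm (x - y) <= r * l K.
Hypothesis box_le : forall K, touching K -> exists c,
  forall x, hull K x -> `|x.1 - c.1| <= r * l K /\ `|x.2 - c.2| <= r * l K.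
Hypothesis edge_ge : forall K, touching K ->
  forall z0 z1, [fset z0; z1]%fset \in edges K -> l K <= enorm (z1 - z0).
Hypothesis diff_le : forall K, touching K -> forall x, hull K x ->
  [/\ `|peval (d1 (v (par K) - vhat K)) x| <= A K,
      `|peval (d2 (v (par K) - vhat K)) x| <= A K &
      `|laplacian (v (par K) - vhat K) x| <= A K / l K].

Let tri K : K \in T -> is_triangle K. Proof. by case: triT => h _ _; exact: h. Qed.
Let trih K : K \in That -> is_triangle K. Proof. by case: triTh => h _ _; exact: h. Qed.

(** Stands for the squared gradient norm on [K]: an area of order [l K ^ 2] times the squared size
    [A K ^ 2]. *)
Let W K := (A K * l K) ^+ 2.

Lemma W_ge0 K : 0 <= W K. Proof. exact: sqr_ge0. Qed.

Lemma adjacent_touching K E Kh : K \in T -> E \in edges K -> Kh \in That ->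
  E \in edges Kh -> touching Kh.
Proof.
move=> KT EK KhT EKh; split => //; exists E => //.
exact: (par_edge triT parT par_hull KT EK KhT EKh).
Qed.

Lemma triangle_edge K : is_triangle K -> exists E, E \in edges K.
Proof.
move=> tK; have [a [b [c [KE h]]]] := tK; have [ab _ _] := det3_neq0 h.
by exists [fset a; b]%fset; apply/(edgeP _ _ tK); split => //; exists c.
Qed.

Lemma common_touching K : K \in T -> K \in That -> touching K.
Proof.
move=> KT KTh; have [E EK] := triangle_edge (tri KT).
exact: (adjacent_touching KT EK KTh EK).
Qed.

(** Each triangle at [E] contributes at most [2 * A], and [(2 * a + 2 * b) ^ 2 <= 8 * (a ^ 2 + b ^
    2)]. *)
Lemma jump_diff_bound K E n : K \in T -> K \in That -> E \in edges K ->
  `|n.1| <= 1 -> `|n.2| <= 1 -> exists S, [/\ 0 <= S,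
    S ^+ 2 <= 8 * \sum_(Kh <- That | E \in edges Kh) A Kh ^+ 2 &
    forall x, hull E x -> `|dot (grad_jump Omega T o v E x) n -
                   dot (grad_jump Omega That o vhat E x) n| <= S].
Proof.
move=> KT KTh EK n1 n2.
have hullE Kh x : E \in edges Kh -> hull E x -> hull Kh x.
  by move=> EKh; apply: hull_sub; exact: edge_sub_triangle.
have grad_le Kh x : Kh \in That -> E \in edges Kh -> hull E x ->
    `|dot (grad (v (par Kh) - vhat Kh) x) n| <= 2 * A Kh.
  move=> KhT EKh xE; have tKh := adjacent_touching KT EK KhT EKh.
  have [a1 a2 _] := diff_le tKh (hullE _ _ EKh xE); exact: dot_bound.
have dotB x y : dot x n - dot y n = dot (x - y) n by rewrite /dot /=; ring.
rewrite /grad_jump /jump; case: asboolP => [bE|nb].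
  have [-> ->] := par_KL_boundary domO triT triTh orT orTh bE KT KTh EK.
  exists (2 * A K); split; first by rewrite mulr_ge0.
    rewrite -big_filter (bigD1_seq K) ?mem_filter ?EK ?filter_uniq ?fset_uniq //=.
    have : 0 <= \sum_(i <- [seq i <- That | E \in edges i] | i != K) A i ^+ 2.
      by apply: sumr_ge0 => *; exact: sqr_ge0.
    by rewrite exprMn; have := sqr_ge0 (A K); lra.
  move=> x xE; rewrite dotB -gradB.
  have pK := par_id triT triTh orT orTh parT par_hull KT KTh.
  by have := grad_le K x KTh EK xE; rewrite pK.
have [K1 [K2 [[K1T E1 K2T E2] ne KL1 KR1 [KL2 KR2]]]] :=
  par_KLR domO triT triTh orT orTh parT par_hull nb KT KTh EK.
rewrite KL1 KR1 KL2 KR2.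
exists (2 * A K1 + 2 * A K2); split; first by rewrite addr_ge0 // mulr_ge0.
  rewrite -big_filter (bigD1_seq K1) ?mem_filter ?E1 ?filter_uniq ?fset_uniq //=.
  rewrite -big_filter (bigD1_seq K2) ?mem_filter ?E2 1?eq_sym ?ne ?filter_uniq ?fset_uniq //=.
  have : 0 <= \sum_(i <- [seq i <- [seq i <- That | E \in edges i] | i != K1] | i != K2) A i ^+ 2.
    by apply: sumr_ge0 => *; exact: sqr_ge0.
  have := sqr_ge0 (A K1 - A K2); nra.
move=> x xE; rewrite dotB.
have -> : grad (v (par K1)) x - grad (v (par K2)) x - (grad (vhat K1) x - grad (vhat K2) x)
    = grad (v (par K1) - vhat K1) x - grad (v (par K2) - vhat K2) x.
  by rewrite !gradB !opprB addrACA [RHS]addrACA; congr (_ + _); exact: addrC.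
rewrite -dotB; apply: le_trans (ler_normB _ _) _.
by apply: lerD; exact: grad_le.
Qed.

Lemma edge_term_close K E n : K \in T -> K \in That -> E \in edges K ->
  `|n.1| <= 1 -> `|n.2| <= 1 ->
  sqrt_close (edge_L2norm o E (fun x => dot (grad_jump Omega T o v E x) n) ^+ 2)
    (edge_L2norm o E (fun x => dot (grad_jump Omega That o vhat E x) n) ^+ 2)
    (elen o E * (8 * \sum_(Kh <- That | E \in edges Kh) A Kh ^+ 2)).
Proof.
move=> KT KTh EK n1 n2; have [S [S0 S2 hS]] := jump_diff_bound KT KTh EK n1 n2.
have [P hP] := jump_dir Omega T o v E n.
have [Q hQ] := jump_dir Omega That o vhat E n.
have EE := oriented_edge orT KT EK.
have ne : (o E).1 != (o E).2.
  by have := EK; rewrite {1}EE => /(edgeP _ _ (tri KT))[].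
apply: (@sqrt_close_sqr _ _ _ (Num.sqrt (elen o E) * S)); rewrite ?sqrtr_ge0 //.
  apply: (edge_norm_diff S0 hP hQ) => t t01; apply: hS.
  by rewrite [X in hull X]EE; apply/(hull2P _ ne); exists t.
by rewrite exprMn sqr_sqrtr ?enorm_ge0 // ler_wpM2l ?enorm_ge0.
Qed.

(** The edge transfers sizes between its triangles: the root of the area of [K] is at most
    [4 * r * l K], hence at most [4 * r] times the length of [E], which is at most [r * l Kh]. With
    the 8 from the jump this gives 32. *)
Lemma weight_bound K E : K \in T -> K \in That -> E \in edges K ->
  Num.sqrt (area K) * (elen o E * (8 * \sum_(Kh <- That | E \in edges Kh) A Kh ^+ 2))
  <= 32 * r ^+ 3 * \sum_(Kh <- That | E \in edges Kh) W Kh.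
Proof.
move=> KT KTh EK; have tK := common_touching KT KTh.
have EE := oriented_edge orT KT EK.
have EK' : [fset (o E).1; (o E).2]%fset \in edges K by rewrite -EE.
have len_ge : l K <= elen o E by exact: edge_ge tK _ _ EK'.
have [c hc] := box_le tK.
have rl : 0 < r * l K by apply: mulr_gt0 (l_gt0 K); exact: lt_le_trans ltr01 r1.
have [_ sa] := area_bound (trih KTh) rl hc.
have r0 : 0 <= r by exact: le_trans ler01 r1.
have sa' : Num.sqrt (area K) <= 4 * r * elen o E.
  apply: le_trans sa _; rewrite mulrA ler_wpM2l //; lra.
have len0 : 0 <= elen o E by exact: enorm_ge0.
rewrite !mulrA !mulr_sumr big_seq_cond [leRHS]big_seq_cond.
apply: ler_sum => Kh /andP[KhT EKh].
have tKh := adjacent_touching KT EK KhT EKh.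
have len_le : elen o E <= r * l Kh.
  have sub := edge_sub_triangle EKh; rewrite EE in sub.
  by apply: size_le => //; apply: hull_vertex; apply: (fsubsetP sub); rewrite !inE eqxx ?orbT.
rewrite /W exprMn.
have s1 : Num.sqrt (area K) * elen o E <= 4 * r * (r * l Kh) ^+ 2.
  apply: (@le_trans _ _ (4 * r * elen o E * elen o E)); first by rewrite ler_wpM2r.
  rewrite -mulrA -expr2 ler_wpM2l ?mulr_ge0 // lerXn2r ?nnegrE //.
  exact: le_trans len_le.
have A2 := sqr_ge0 (A Kh).
have := ler_wpM2r A2 s1.
move: (A Kh ^+ 2) (Num.sqrt (area K) * elen o E) => a s h.
lra.
Qed.

(** 256 is [4 ^ 4], from [area K ^ 2 <= (4 * (r * l K)) ^ 4] and a Laplacian difference of at most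
    [A K / l K]; 64 is twice 32, for the normal and the tangential jumps. *)
Lemma cell_close K : K \in T -> K \in That ->
  sqrt_close (eta2 Omega T o v K f) (eta2 Omega That o vhat K f)
    (256 * r ^+ 4 * W K +
     64 * r ^+ 3 * \sum_(E <- edges K) \sum_(Kh <- That | E \in edges Kh) W Kh).
Proof.
move=> KT KTh; have tK := common_touching KT KTh.
have [c hc] := box_le tK.
have rl : 0 < r * l K by apply: mulr_gt0 (l_gt0 K); exact: lt_le_trans ltr01 r1.
have [_ sa] := area_bound (trih KTh) rl hc.
have area0 : 0 <= area K by rewrite /area fine_ge0 ?measure_ge0.
have r0 : 0 <= r by exact: le_trans ler01 r1.
have pK := par_id triT triTh orT orTh parT par_hull KT KTh.
pose V E := \sum_(Kh <- That | E \in edges Kh) W Kh.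
have V0 E : 0 <= V E by apply: sumr_ge0 => *; exact: W_ge0.
have [w wE] : exists w, w = 32 * r ^+ 3 by exists (32 * r ^+ 3).
have w0 : 0 <= w by rewrite wE mulr_ge0 // exprn_ge0.
have dir_ne E : E \in edges K -> (o E).1 != (o E).2.
  by move=> EK; have := EK; rewrite {1}(oriented_edge orT KT EK) => /(edgeP _ _ (tri KT))[].
have edge_close E n : E \in edges K -> `|n.1| <= 1 -> `|n.2| <= 1 ->
    sqrt_close
      (Num.sqrt (area K) *
         edge_L2norm o E (fun x => dot (grad_jump Omega T o v E x) n) ^+ 2)
      (Num.sqrt (area K) *
         edge_L2norm o E (fun x => dot (grad_jump Omega That o vhat E x) n) ^+ 2)
      (w * V E).
  move=> EK n1 n2; rewrite wE; apply: sqrt_close_le (weight_bound KT KTh EK) _.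
  by apply: sqrt_closeZ; [exact: sqrtr_ge0|exact: (edge_term_close KT KTh EK n1 n2)].
have -> : 256 * r ^+ 4 * W K + 64 * r ^+ 3 * (\sum_(E <- edges K) V E) =
    256 * r ^+ 4 * W K + w * (\sum_(E <- edges K) V E)
    + w * (\sum_(E <- edges K) V E) by rewrite wE; ring.
rewrite /eta2 /mu2 /nu2; apply: sqrt_closeD; first apply: sqrt_closeD.
- have := @sqrt_close_sqr R (L2norm (hull K) (fun x => (f \_ Omega) x + laplacian (v K) x))
    (L2norm (hull K) (fun x => (f \_ Omega) x + laplacian (vhat K) x))
    (A K / l K * Num.sqrt (area K)) _
    (fine_ge0 (Lnorm_ge0 _ _ _)) (fine_ge0 (Lnorm_ge0 _ _ _)).
  move=> /(_ _ _ (lexx _)) cl.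
  apply: (@sqrt_close_le _ _ _ (area K * (A K / l K * Num.sqrt (area K)) ^+ 2)); last first.
    apply: sqrt_closeZ => //; apply: cl; apply: cell_norm_diff => //; first exact: tri.
      by rewrite divr_ge0 // ltW.
    by move=> x xK; rewrite -laplacianB; have [_ _] := diff_le tK xK; rewrite pK.
  rewrite exprMn sqr_sqrtr //.
  have s0 : 0 <= Num.sqrt (area K) by exact: sqrtr_ge0.
  have aE : area K = Num.sqrt (area K) ^+ 2 by rewrite sqr_sqrtr.
  have a4 : area K * area K <= (4 * (r * l K)) ^+ 4.
    rewrite -expr2 {1}aE -exprM lerXn2r ?nnegrE //; exact: le_trans sa.
  have lK := l_gt0 K.
  apply: (@le_trans _ _ ((A K / l K) ^+ 2 * (4 * (r * l K)) ^+ 4)).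
    by rewrite mulrCA ler_wpM2l ?sqr_ge0.
  by rewrite /W le_eqVlt; apply/orP; left; apply/eqP; field; exact: lt0r_neq0.
- apply: (@sqrt_close_le _ _ _
    (w * \sum_(E <- edges K | ~~ `[< boundary_edge Omega E >]) V E)).
    rewrite ler_wpM2l // [leRHS](bigID (fun E => ~~ `[< boundary_edge Omega E >])) /= lerDl.
    by apply: sumr_ge0 => *; exact: V0.
  rewrite [X in sqrt_close X]mulr_sumr [X in sqrt_close _ X]mulr_sumr.
  rewrite [X in sqrt_close _ _ X]mulr_sumr.
  apply: sqrt_close_sum => E EK _; have [t1 t2] := tangent_coord (dir_ne _ EK).
  by apply: edge_close => //; rewrite /normal /rot90 /= ?normrN.
- rewrite [X in sqrt_close X]mulr_sumr [X in sqrt_close _ X]mulr_sumr.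
  rewrite [X in sqrt_close _ _ X]mulr_sumr; apply: sqrt_close_sum => E EK _.
  by have [t1 t2] := tangent_coord (dir_ne _ EK); exact: edge_close.
Qed.

(** Counting all subsets of the three vertices is enough. *)
Lemma card_edges K : K \in That -> (#|` edges K|%fset <= 8)%N.
Proof.
move=> KTh; have := card_fpowerset K; rewrite (card_triangle (trih KTh)) -[(2 ^ 3)%N]/8%N => <-.
by apply: fsubset_leq_card; apply/fsubsetP => E; rewrite /edges in_fset => /andP[].
Qed.

(** After exchanging the sums, [W Kh] occurs once for each edge of [Kh] and each common triangle
    with that edge: at most 8 times 2. *)
Lemma edge_multiplicity :
  \sum_(K <- (T `&` That)%fset) \sum_(E <- edges K)
    \sum_(Kh <- That | E \in edges Kh) W Kh <= 16 * \sum_(Kh <- That) W Kh.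
Proof.
have -> : \sum_(K <- (T `&` That)%fset) \sum_(E <- edges K)
    \sum_(Kh <- That | E \in edges Kh) W Kh =
    \sum_(Kh <- That) \sum_(E <- edges Kh)
      \sum_(K <- (T `&` That)%fset | E \in edges K) W Kh.
  transitivity (\sum_(K <- (T `&` That)%fset) \sum_(Kh <- That)
      \sum_(E <- edges Kh | E \in edges K) W Kh).
    apply: eq_bigr => K _; rewrite (exchange_big_dep xpredT) //=.
    by apply: eq_bigr => Kh _; exact: sum_filter_sym.
  rewrite exchange_big /=; apply: eq_bigr => Kh _.
  by rewrite (exchange_big_dep xpredT).
rewrite mulr_sumr big_seq [leRHS]big_seq; apply: ler_sum => Kh KhT.
apply: (@le_trans _ _ (\sum_(E <- edges Kh) W Kh *+ 2)).
  apply: ler_sum => E _; rewrite big_const_seq iter_addr_0.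
  apply: ler_wpMn2l; first exact: W_ge0.
  rewrite -size_filter; apply: leq_trans (card_adjacent triT orT E).
  apply: uniq_leq_size; first by rewrite filter_uniq ?fset_uniq.
  move=> K; rewrite mem_filter in_fsetI => /andP[EK /andP[KT _]].
  by rewrite in_fset /=; apply/andP.
rewrite big_const_seq iter_addr_0 count_predT -mulrnA mulr_natl.
apply: ler_wpMn2l; first exact: W_ge0.
by rewrite -[16%N]/(2 * 8)%N leq_mul2l card_edges.
Qed.

(** 1024 is 64 times the multiplicity 16. *)
Lemma eta_diff_le :
  `|eta Omega T o v (T `&` That)%fset f - eta Omega That o vhat (That `&` T)%fset f|
  <= Num.sqrt ((256 * r ^+ 4 + 1024 * r ^+ 3) * \sum_(K <- That) W K).
Proof.
rewrite [(That `&` T)%fset]fsetIC; apply: sqrt_close_dist.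
have r0 : 0 <= r by exact: le_trans ler01 r1.
have sumW0 : 0 <= \sum_(K <- That) W K by apply: sumr_ge0 => *; exact: W_ge0.
apply: sqrt_close_le (sqrt_close_sum (H := fun K => 256 * r ^+ 4 * W K +
     64 * r ^+ 3 * \sum_(E <- edges K) \sum_(Kh <- That | E \in edges Kh) W Kh) _); last first.
  by move=> K; rewrite in_fsetI => /andP[KT KTh] _; exact: cell_close.
rewrite big_split /= -!mulr_sumr [leRHS]mulrDl; apply: lerD.
  apply: ler_wpM2l; first by rewrite mulr_ge0 // exprn_ge0.
  have -> : \sum_(K <- (T `&` That)%fset) W K = \sum_(K <- That | K \in T) W K.
    rewrite -[RHS]big_filter; apply: perm_big; apply: uniq_perm; rewrite ?filter_uniq ?fset_uniq //.
    by move=> K; rewrite mem_filter in_fsetI.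
  by rewrite [leRHS](bigID (fun K => K \in T)) /= lerDl sumr_ge0 // => *; exact: W_ge0.
rewrite (_ : 1024 * r ^+ 3 * _ = 64 * r ^+ 3 * (16 * \sum_(K <- That) W K)); last by ring.
by rewrite ler_wpM2l ?mulr_ge0 ?exprn_ge0 //; exact: edge_multiplicity.
Qed.

End TwoMeshEstimate.

(** * Choice of the constant *)

Section Main.
Context {R : realType}.

(** [g] is the prescribed value of [gamma T], so the constant is fixed before the domain, the mesh
    and the data are introduced. *)
Lemma estimator_difference k (g : R) : exists C : R, 0 < C /\
  forall (Omega : set (pt R)) (T : {fset cell R}) (nv : cell R -> pt R) (f : pt R -> R),
  polygonal_lipschitz_domain Omega -> triangulation Omega T ->
  f \_ Omega \in Lfun leb2 2%:E -> gamma T = g ->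
  forall (That : {fset cell R}) (o : cell R -> pt R * pt R)
    (v vhat : cell R -> {poly {poly R}}),
  admissible_refinement Omega T nv That ->
  orientation Omega T o -> orientation Omega That o ->
  piecewise_poly k T v -> piecewise_poly k That vhat ->
  `| eta Omega T o v (T `&` That)%fset f - eta Omega That o vhat (That `&` T)%fset f |
  <= C * L2norm Omega (fun x => enorm (pgrad T v x - pgrad That vhat x)).
Proof.
(* The absolute value gives [r >= 1] for every real [g], whether or not it is the shape constant of
   a mesh. *)
pose r := 32 * `|g| + 1.
have r1 : 1 <= r by rewrite lerDr mulr_ge0.
have [delta [kappa [delta0 kappa0 loc]]] := local_inverse k r1.
(* A box of half-side [delta * l] has area [4 * (delta * l) ^ 2], and the gradient is at least
   [kappa * A] on it. *)
pose D := 4 * kappa ^+ 2 * delta ^+ 2; pose C0 := 256 * r ^+ 4 + 1024 * r ^+ 3.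
have D0 : 0 < D by rewrite !mulr_gt0 // exprn_gt0.
have C00 : 0 <= C0.
  have r0 := le_trans ler01 r1; rewrite /C0.
  by move: (exprn_ge0 4 r0) (exprn_ge0 3 r0); lra.
exists (Num.sqrt (C0 / D) + 1); split; first by rewrite ltr_wpDl // sqrtr_ge0.
move=> Omega T nv f domO triT fL2 gT That o v vhat [triTh [nv' reach]] orT orTh pv pvh.
have [tri _ _] := triT; have [trih _ _] := triTh.
have desc := nvb_reach_descends tri reach.
have /choice[par hpar] : forall K, exists K', K \in That -> K' \in T /\ descends K' K (nv' K).
  move=> K; case: (boolP (K \in That)) => [KT|nK]; last by exists K.
  by have [K' K'T ds] := desc _ KT; exists K'.
have parT K : K \in That -> par K \in T by move=> /hpar[].
have par_hull K : K \in That -> hull K `<=` hull (par K).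
  by move=> KT; have [pT ds] := hpar _ KT; exact: descends_hull (tri _ pT) ds.
pose touching K := K \in That /\ exists2 E, E \in edges K & E \in edges (par K).
pose p K := v (par K) - vhat K.
have /choice[dat hdat] : forall K, exists dat : R * R * set (pt R),
    let l := dat.1.1 in let A := dat.1.2 in let B := dat.2 in
    [/\ 0 < l, 0 <= A,
      [/\ measurable (B : set (measurableTypeR R * measurableTypeR R)), (leb2 B < +oo)%E &
        (kappa * A) ^+ 2 * fine (leb2 B) = D * (A * l) ^+ 2],
      K \in That -> B `<=` interior (hull K) /\
        forall x, B x -> kappa * A <= enorm (grad (p K) x) &
      touching K -> [/\ forall x y, hull K x -> hull K y -> enorm (x - y) <= r * l,
        exists c, forall x, hull K x -> `|x.1 - c.1| <= r * l /\ `|x.2 - c.2| <= r * l,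
        forall z0 z1, [fset z0; z1]%fset \in edges K -> l <= enorm (z1 - z0) &
        forall x, hull K x -> [/\ `|peval (d1 (p K)) x| <= A,
          `|peval (d2 (p K)) x| <= A & `|laplacian (p K) x| <= A / l]]].
  move=> K; have [tK|ntK] := pselect (touching K); last first.
    (* For the remaining triangles an empty box with [A = 0] and [l = 1] satisfies the requirements
       and contributes nothing. *)
    exists (1, 0, set0) => /=; split => //.
    - split; [exact: measurable0|by rewrite measure0 ltry|].
      by rewrite measure0 mulr0 mul0r expr0n mulr0.
    - by split => // x [].
  have [KTh [E EK EpK]] := tK; have [pT ds] := hpar _ KTh.
  have [c [l [l0 boxi size bx edge]]] := shape_regular_box (trih _ KTh) (tri _ pT) pT
    (shared_edge_half ds EK EpK) (par_hull _ KTh).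
  have dp : total_degree_le k (p K) by apply: total_degreeB; [exact: pv|exact: pvh].
  have [A [c' [A0 bd sub low]]] := loc _ c _ l0 dp.
  have dl : 0 < delta * l by exact: mulr_gt0.
  have rl : 32 * gamma T * l <= r * l.
    by rewrite ler_wpM2r ?(ltW l0) // gT /r; have := ler_norm g; lra.
  have bx' x : hull K x -> `|x.1 - c.1| <= r * l /\ `|x.2 - c.2| <= r * l.
    by move=> /bx[x1 x2]; split; apply: le_trans rl.
  exists (l, A, box c' (delta * l)) => /=; split => //.
  - split; [exact: measurable_box|by rewrite leb2_box // ltry|].
    by rewrite leb2_box //= /D; ring.
  - by move=> _; split => //; exact: subset_trans sub boxi.
  - move=> _; split => //.
    + by move=> x y xK yK; apply: le_trans rl; exact: size.
    + by exists c.
    + by move=> x /bx'[x1 x2]; exact: bd.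
pose l K := (dat K).1.1; pose A K := (dat K).1.2; pose B K := (dat K).2.
have l0 K : 0 < l K by have [] := hdat K.
have A0 K : 0 <= A K by have [] := hdat K.
have hB K : [/\ measurable (B K : set (measurableTypeR R * measurableTypeR R)),
    (leb2 (B K) < +oo)%E &
    (kappa * A K) ^+ 2 * fine (leb2 (B K)) = D * (A K * l K) ^+ 2] by have [] := hdat K.
have hT K : K \in That -> B K `<=` interior (hull K) /\
    forall x, B K x -> kappa * A K <= enorm (grad (p K) x) by have [] := hdat K.
have ht K : touching K -> _ := let: And5 _ _ _ _ h := hdat K in h.
set N := L2norm _ _.
have lower : D * \sum_(K <- That) (A K * l K) ^+ 2 <= N ^+ 2.
  rewrite mulr_sumr; under eq_bigr => K _ do [have [_ _ <-] := hB K].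
  apply: (pgrad_diff_lower (par := par)) => //.
  - by move=> K; rewrite mulr_ge0 // ltW.
  - by move=> K; have [] := hB K.
  - by move=> K; have [] := hB K.
  - by move=> K /hT[].
  - by move=> K x /hT[_]; exact.
have N0 : 0 <= N by apply: fine_ge0; exact: Lnorm_ge0.
apply: le_trans (eta_diff_le domO triT triTh orT orTh parT par_hull fL2 r1 l0 A0 _ _ _ _) _.
- by move=> K /ht[].
- by move=> K /ht[].
- by move=> K /ht[].
- by move=> K /ht[].
apply: (@le_trans _ _ (Num.sqrt (C0 / D * N ^+ 2))).
  rewrite ler_wsqrtr // -/C0 -mulrA ler_wpM2l //.
  by rewrite mulrC ler_pdivlMr // mulrC.
rewrite sqrtrM ?divr_ge0 ?(ltW D0) // sqrtr_sqr ger0_norm //.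
by rewrite [leRHS]mulrDl mul1r lerDl.
Qed.

End Main.

Theorem lemma8p1 (R : realType) :
  exists C : nat -> R -> R, (forall (k : nat) (g : R), 0 < C k g) /\
  forall (k : nat) (Omega : set (R * R)) (T : {fset {fset (R * R)}})
    (nv : {fset (R * R)} -> R * R) (f : R * R -> R),
  (1 <= k)%N -> odd k ->
  polygonal_lipschitz_domain Omega ->
  triangulation Omega T -> newest_vertices T nv ->
  f \_ Omega \in Lfun leb2 2%:E ->
  forall (That : {fset {fset (R * R)}})
    (o : {fset (R * R)} -> (R * R) * (R * R))
    (v vhat : {fset (R * R)} -> {poly {poly R}}),
  admissible_refinement Omega T nv That ->
  orientation Omega T o -> orientation Omega That o ->
  CR0 k Omega T o v -> CR0 k Omega That o vhat ->
  `| eta Omega T o v (T `&` That)%fset f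
     - eta Omega That o vhat (That `&` T)%fset f |
  <= C k (gamma T)
     * L2norm Omega (fun x => enorm (pgrad T v x - pgrad That vhat x)).
Proof.
(* Choice over the pairs [(k, g)] turns the constants into one function. *)
have /choice[C hC] := fun kg : nat * R => estimator_difference kg.1 kg.2.
exists (fun k g => C (k, g)); split; first by move=> k g; have [] := hC (k, g).
move=> k Omega T nv f _ _ domO triT _ fL2 That o v vhat ref orT orTh [pv _] [pvh _].
have [_ h] := hC (k, gamma T).
exact: (h Omega T nv f domO triT fL2 erefl That o v vhat ref orT orTh pv pvh).
Qed.
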